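(* Let $n\geq 219$ and let $G$ be a 2-connected claw-free graph on $n$ vertices. If $\mu(\overline{G})\leq\mu(\overline{EP'_n})$, then $G$ is Hamiltonian unless $G\cong EP'_n$.
   Context: All graphs are finite and simple; $\overline{H}$ denotes the complement of $H$. A graph is claw-free if it has no induced subgraph isomorphic to $K_{1,3}$. $\mu(H)$ denotes the spectral radius (largest adjacency eigenvalue) of $H$. For $n\geq 9$, $EP'_n$ is the graph on $n$ vertices defined as follows: take a clique $Q$ on $n-6$ vertices with two distinct distinguished vertices $a_1,b_1\in Q$, and six further vertices $a_2,a_3,b_2,b_3,c_2,c_3$; the edges are all pairs inside $Q$, the edges $a_1a_2,a_2a_3,a_1a_3$, $b_1b_2,b_2b_3,b_1b_3$, and for each $i\in\{2,3\}$ the edges $a_ib_i$, $a_ic_i$, $b_ic_i$ (and no others). *)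

(* Defs.v *)
From mathcomp Require Import all_boot all_order all_algebra.
From mathcomp Require Import classical_sets reals.

Set Implicit Arguments.
Unset Strict Implicit.
Unset Printing Implicit Defensive.

Import Order.TTheory GRing.Theory Num.Theory.

Record sgraph := SGraph {
  vertex :> finType;
  adj : rel vertex;
  adj_sym : symmetric adj;
  adj_irrefl : irreflexive adj }.
Arguments adj {s} : rename.

Definition closure_adj (T : finType) (r : rel T) : rel T :=
  fun x y => (x != y) && (r x y || r y x).

Lemma closure_adj_sym T r : symmetric (@closure_adj T r).
Proof. by move=> x y; rewrite /closure_adj eq_sym orbC. Qed.

Lemma closure_adj_irrefl T r : irreflexive (@closure_adj T r).
Proof. by move=> x; rewrite /closure_adj eqxx. Qed.

Definition graph_of (T : finType) (r : rel T) : sgraph :=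
  SGraph (@closure_adj_sym T r) (@closure_adj_irrefl T r).

Definition compl_adj (G : sgraph) : rel G :=
  fun x y => (x != y) && ~~ adj x y.

Lemma compl_adj_sym (G : sgraph) : symmetric (@compl_adj G).
Proof. by move=> x y; rewrite /compl_adj eq_sym adj_sym. Qed.

Lemma compl_adj_irrefl (G : sgraph) : irreflexive (@compl_adj G).
Proof. by move=> x; rewrite /compl_adj eqxx. Qed.

Definition compl (G : sgraph) : sgraph :=
  SGraph (@compl_adj_sym G) (@compl_adj_irrefl G).

Definition isomorphic (G H : sgraph) : Prop :=
  exists f : G -> H, bijective f /\ forall x y, adj (f x) (f y) = adj x y.

Definition has_induced (G H : sgraph) : Prop :=
  exists f : H -> G, injective f /\ forall x y, adj (f x) (f y) = adj x y.

Definition complete_bipartite (p q : nat) : sgraph :=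
  graph_of (fun x y : 'I_p + 'I_q => is_inl x && ~~ is_inl y).

Definition claw_free (G : sgraph) : Prop :=
  ~ has_induced G (complete_bipartite 1 3).

Definition del_adj (G : sgraph) (X : {set G}) : rel G :=
  fun x y => [&& x \notin X, y \notin X & adj x y].

Definition k_connected (k : nat) (G : sgraph) : Prop :=
  k < #|G| /\
  forall X : {set G}, #|X| < k ->
    forall x y : G, x \notin X -> y \notin X -> connect (del_adj X) x y.

Definition hamiltonian (G : sgraph) : Prop :=
  exists c : seq G, [/\ 2 < size c, ucycle adj c & forall x, x \in c].

Definition adj_mx (R : realType) (G : sgraph) : 'M[R]_#|G| :=
  (\matrix_(i, j) (adj (enum_val i) (enum_val j))%:R)%R.

(* The adjacency matrix is symmetric, so when [G] has a vertex this set is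
   finite and nonempty, and its supremum is the largest eigenvalue. *)
Definition mu (R : realType) (G : sgraph) : R :=
  sup [set a : R | eigenvalue (adj_mx R G) a]%classic.

(* The clique Q is {0, ..., n - 7}, with a1 = 0 and b1 = 1; the remaining six
   vertices are n - 6, ..., n - 1.  Meaningful only for n >= 9. *)
Definition EP'_edges (n : nat) : seq (nat * nat) :=
  let q := n - 6 in
  let a1 := 0 in let b1 := 1 in
  let a2 := q in let a3 := q + 1 in
  let b2 := q + 2 in let b3 := q + 3 in
  let c2 := q + 4 in let c3 := q + 5 in
  [:: (a1, a2); (a2, a3); (a1, a3);
      (b1, b2); (b2, b3); (b1, b3);
      (a2, b2); (a2, c2); (b2, c2);
      (a3, b3); (a3, c3); (b3, c3)].

Definition EP' (n : nat) : sgraph :=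
  graph_of (fun x y : 'I_n =>
    (x < n - 6) && (y < n - 6) || ((x : nat, y : nat) \in EP'_edges n)).

(* Main.v *)
(* Completing the neighbourhoods that are connected but not complete
   (Ryjacek's closure) neither creates claws nor makes a graph Hamiltonian that was
   not.  So [G] extends to a claw-free graph [F] without diamonds.  There
   nonadjacent vertices have at most two common neighbours, hence every edge [uv] of
   the complement satisfies [d u + d v >= n - 2]; as the sum of the [d u ^ 2] is at
   most [n * mu ^ 2], the complement has little more than [6 * n] edges, and [F] has a
   clique that misses at most six vertices.  A finite search over these vertices
   shows that [F] is Hamiltonian unless there are six of them and either they span at
   most seven edges or [F] is EP'.  In the former case a Rayleigh quotient exceeds
   the spectral radius of the complement of EP'.  In the latter case [G] is all of
   [F], because the spectral radius of a connected graph grows strictly when an edge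
   is added. *)
Require Import Defs.
From mathcomp Require Import all_boot all_order all_algebra.
From mathcomp Require Import reals.
From mathcomp Require all_classical topology normedtype derive.
From mathcomp Require Import ring lra zify.

Set Implicit Arguments.
Unset Strict Implicit.
Unset Printing Implicit Defensive.

Import Order.TTheory GRing.Theory Num.Theory.

(** * Spanning paths and diamonds *)

(** When six vertices lie outside a clique of [n - 6] and each has at most one neighbour in it, the
    complement is nearly complete bipartite between the two sides. Its spectral radius is
    [sqrt (6 * n)] to first order whatever the six vertices span, so only the next term can separate
    the remaining graphs. At most seven edges among the six leave at least 16 ordered nonadjacent
    pairs, 8/3 per vertex on average; the eight edges of EP' leave 14. This decides which cases the
    finite search may hand over to the spectral estimate. No spectral radius is computed: both sides
    are compared with one number [t] such that [t^2 = 5/2 * t + 6 * n - 44]. It also satisfies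
    [t^2 <= 25/4 * n], and as 25/4 is below 7, a seventh outside vertex would already cost too many
    complement edges. The search can be finite because an outside vertex has at most one neighbour
    in the clique, and any two clique vertices can be joined: only the partition of the outside
    vertices by their clique neighbour matters. *)

Definition ham_rel (T : finType) (r : rel T) :=
  exists c : seq T, [/\ 2 < size c, ucycle r c & forall x, x \in c].

Ltac perm_count := let z := fresh in apply/permP => z;
  rewrite /= ?(count_cat, count_rev) /= ?(count_cat, count_rev) /= ?(count_cat, count_rev) /=;
  repeat match goal with
  | |- context [nat_of_bool ?b] => let k := fresh in set k := nat_of_bool b; clearbody k
  | |- context [count ?p ?l] => let k := fresh in set k := count p l; clearbody k
  end; clear; lia.

Section Paths.
Variables (T : finType) (r : rel T).
Hypothesis rC : symmetric r.

Definition hpath (a b : T) (s : seq T) :=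
  if s is x :: t then [&& x == a, last x t == b & path r x t] else false.

Lemma hpath1 a : hpath a a [:: a].
Proof. by rewrite /= !eqxx. Qed.

Lemma hpath_cat a b c d s t :
  hpath a b s -> r b c -> hpath c d t -> hpath a d (s ++ t).
Proof.
case: s t => [|x s] // [|y t] // /and3P[/eqP-> /eqP lb ps] bc /and3P[/eqP-> ld pt].
by rewrite /= last_cat cat_path eqxx ps lb /= ld bc pt.
Qed.

Lemma hpath_catI a b s t : s != [::] -> t != [::] -> hpath a b (s ++ t) ->
  exists c d, [/\ hpath a c s, r c d & hpath d b t].
Proof.
case: s t => [|x s] // [|y t] // _ _ /and3P[/eqP->]; rewrite last_cat cat_path /=.
move=> lb /and3P[ps lsy pt]; exists (last a s), y.
by rewrite /= !eqxx ps lsy lb pt.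
Qed.

Lemma hpath_mid a b s x t : hpath a b (s ++ x :: t) -> x != a -> x != b ->
  exists c d, [/\ hpath a c s, r c x, r x d & hpath d b t].
Proof.
move=> h xa xb; have nn (y : T) l : y :: l != [::] by [].
have s0 : s != [::] by case: s h => // /and3P[]; rewrite (negPf xa).
have t0 : t != [::].
  case: t h => // h; have [c [d [_ _ /and3P[_ /= xb']]]] := hpath_catI s0 (nn _ _) h.
  by rewrite xb' in xb.
have [c [d [h1 cd]]] := hpath_catI s0 (nn _ _) h.
rewrite -cat1s => h2; have [e [f [/and3P[/= /eqP xd /eqP xe _] ef h3]]] := hpath_catI (nn _ _) t0 h2.
by subst; exists c, f.
Qed.

Lemma hpath_rev a b s : hpath a b s -> hpath b a (rev s).
Proof.
case: s => [|x s] // /and3P[/eqP-> /eqP lb ps].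
rewrite lastI rev_rcons lb /= eqxx /=.
have : path r b (rev (belast a s)) by rewrite -lb rev_path; under eq_path do rewrite rC.
move=> ->; rewrite andbT; case: s lb {ps} => [<-|y s lb] /=; first by rewrite eqxx.
by rewrite rev_cons last_rcons.
Qed.

Lemma hpath_cycle a b s : hpath a b s -> r b a -> cycle r s.
Proof.
case: s => // x s /and3P[/eqP-> /eqP lb ps] ba.
by rewrite /= rcons_path ps lb.
Qed.

Lemma mem_hpath_head a b s : hpath a b s -> a \in s.
Proof. by case: s => // x s /and3P[/eqP-> _ _]; rewrite mem_head. Qed.

Lemma mem_hpath_last a b s : hpath a b s -> b \in s.
Proof. by case: s => // x s /and3P[_ /eqP<- _]; rewrite mem_last. Qed.

Lemma uniq_catN (x : T) s t : uniq (s ++ t) -> x \in s -> x \in t -> False.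
Proof. by rewrite cat_uniq => /and3P[_ /hasPn n _] xs /n; rewrite xs. Qed.

Definition spanning (s : seq T) := uniq s /\ forall x, x \in s.

Lemma spanning_perm s t : perm_eq s t -> spanning s -> spanning t.
Proof.
move=> st [us fs]; split; first by rewrite -(perm_uniq st).
by move=> x; rewrite -(perm_mem st).
Qed.

Hypothesis T3 : 2 < #|T|.

Lemma ham_hpath a b s : spanning s -> hpath a b s -> r b a -> ham_rel r.
Proof.
move=> [us fs] h ba; exists s; split=> //; last by rewrite /ucycle (hpath_cycle h ba).
rewrite -(card_uniqP us); apply: leq_trans T3 _.
by apply: subset_leq_card; apply/subsetP => x _; exact: fs.
Qed.


(* A spanning path [u .. c x s2 y h .. v] whose inner vertices [x], [y] are
   adjacent to both ends: the two crossing chords close it into a cycle. *)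
Lemma ham_adjacent u v x y c h s1 s3 : spanning (s1 ++ x :: y :: s3) ->
  hpath u c s1 -> r c x -> r x v -> r u y -> r y h -> hpath h v s3 -> ham_rel r.
Proof.
move=> sp h1 cx xv uy yh h3.
apply: (@ham_hpath u y ((s1 ++ [:: x]) ++ rev s3 ++ [:: y])); last by rewrite rC.
  by apply: spanning_perm sp; perm_count.
apply: hpath_cat (xv) _; first exact: hpath_cat h1 cx (hpath1 _).
by apply: hpath_cat (hpath_rev h3) _ (hpath1 _); rewrite rC.
Qed.

(** If [d] sees [u], then [x] is moved between [v] and [c]; if [e] sees [v], the last segment is
    reversed and [y] closes up with [u]. Otherwise [d] sees [v] and [e] sees [u], and the edge [x y]
    links the two reversed outer segments. *)
Lemma ham_inner u v x y c d e h s1 s2 s3 : spanning (s1 ++ x :: s2 ++ y :: s3) ->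
  hpath u c s1 -> r c x -> r x d -> hpath d e s2 -> r e y -> r y h -> hpath h v s3 ->
  r x y -> r u x -> r u y -> r v x -> r v y ->
  r d u || r d v -> r e u || r e v -> ham_rel r.
Proof.
move=> sp h1 cx xd h2 ey yh h3 xy ux uy vx vy covd cove.
have [du|nd] := boolP (r d u).
  apply: (@ham_hpath c x (rev s1 ++ (s2 ++ y :: s3) ++ [:: x])); last by rewrite rC.
    by apply: spanning_perm sp; perm_count.
  apply: hpath_cat (hpath_rev h1) _ _; first by rewrite rC; exact: du.
  apply: hpath_cat (vx) (hpath1 _).
  by apply: hpath_cat h2 ey _; rewrite -cat1s; exact: hpath_cat (hpath1 _) yh h3.
have [ev|ne] := boolP (r e v).
  apply: (@ham_hpath u y ((s1 ++ [:: x] ++ s2) ++ (rev s3 ++ [:: y]))); last by rewrite rC.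
    by apply: spanning_perm sp; perm_count.
  apply: hpath_cat (ev) _.
    by apply: hpath_cat h1 cx _; exact: hpath_cat (hpath1 _) xd h2.
  by apply: hpath_cat (hpath_rev h3) _ (hpath1 _); rewrite rC.
rewrite (negPf nd) in covd; rewrite (negPf ne) orbF in cove.
apply: (@ham_hpath e u (rev s2 ++ (rev s3 ++ [:: y]) ++ ([:: x] ++ rev s1))); last by rewrite rC.
  by apply: spanning_perm sp; perm_count.
apply: hpath_cat (hpath_rev h2) covd _.
apply: hpath_cat; first by apply: hpath_cat (hpath_rev h3) _ (hpath1 _); rewrite rC.
  by rewrite rC; exact: xy.
by apply: hpath_cat (hpath1 _) _ (hpath_rev h1); rewrite rC.
Qed.

Section Ends.
Variables u v : T.

Definition joined (x : T) := r u x && r v x.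
Definition covered (w : T) := r w u || r w v.

Hypothesis rI : irreflexive r.

Lemma joined_ends x : joined x -> x != u /\ x != v.
Proof.
move=> /andP[ux vx]; split; first by apply: contraTneq ux => ->; rewrite rI.
by apply: contraTneq vx => ->; rewrite rI.
Qed.

Lemma covered_joined x : joined x -> covered x.
Proof. by move=> /andP[ux _]; rewrite /covered rC ux. Qed.

Lemma split_pair s1 s2 s3 x y : joined x -> joined y -> spanning (s1 ++ x :: s2 ++ y :: s3) ->
  hpath u v (s1 ++ x :: s2 ++ y :: s3) -> r x y ->
  ham_rel r \/ exists c d e h,
    [/\ hpath u c s1, r c x, r x d & [/\ hpath d e s2, r e y, r y h & hpath h v s3]].
Proof.
move=> jx jy sp h0 xy.
have [xu xv] := joined_ends jx; have [yu yv] := joined_ends jy.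
have [c [d [h1 cx xd h2]]] := hpath_mid h0 xu xv.
(* When [y] directly follows [x], [ham_adjacent] applies; a nonempty middle segment would here make
   [y] occur twice. *)
have [yd|yd] := eqVneq y d.
  case: s2 h2 sp {h0} => [|z s2].
    rewrite cat0s -cat1s => h2 sp; left.
    case: s3 h2 sp => [/and3P[_ /eqP /= e _]|z s3 h2 sp]; first by rewrite e eqxx in yv.
    have [e [f [/and3P[_ /= /eqP<- _] yf h3]]] := hpath_catI (s := [:: y]) (t := z :: s3) isT isT h2.
    apply: (ham_adjacent (u := u) (v := v) sp h1 cx _ _ yf h3).
      by rewrite rC; case/andP: jx.
    by case/andP: jy.
  rewrite cat_cons => /and3P[/eqP zd _ _] [us _]; move: us.
  by rewrite zd -yd cat_uniq /= mem_cat mem_head !orbT /= !andbF.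
have [e [h [h2' ey yh h3]]] := hpath_mid h2 yd yv.
by right; exists c, d, e, h.
Qed.

Lemma ham_diamond_ordered x y s1 s2 s3 : joined x -> joined y ->
  spanning (s1 ++ x :: s2 ++ y :: s3) ->
  hpath u v (s1 ++ x :: s2 ++ y :: s3) -> r x y ->
  (forall w, r x w -> w != u -> w != v -> covered w) ->
  (forall w, r y w -> w != u -> w != v -> covered w) -> ham_rel r.
Proof.
move=> jx jy sp h0 xy cx cy.
have [//|[c [d [e [h [h1 cx' xd [h2 ey yh h3]]]]]]] := split_pair jx jy sp h0 xy.
have [us _] := sp.
have nu w : w \in s2 -> w != u /\ w != v.
  move=> ws; move: us; rewrite cat_uniq => /and3P[_ /hasPn n1].
  rewrite cons_uniq cat_uniq => /andP[_ /and3P[_ /hasPn n2 _]]; split.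
    apply: contraTneq (mem_hpath_head h1) => <-; apply: n1.
    by rewrite inE mem_cat ws orbT.
  apply: contraTneq ws => ->; apply: n2.
  by rewrite inE (mem_hpath_last h3) orbT.
have [du dv] := nu _ (mem_hpath_head h2); have [eu ev] := nu _ (mem_hpath_last h2).
case/andP: jx => ux vx; case/andP: jy => uy vy.
apply: (ham_inner sp h1 cx' xd h2 ey yh h3) => //; first exact: cx.
by apply: cy => //; rewrite rC.
Qed.

End Ends.

Lemma joinedC u v x : joined u v x = joined v u x.
Proof. by rewrite /joined andbC. Qed.

Lemma coveredC u v x : covered u v x = covered v u x.
Proof. by rewrite /covered orbC. Qed.

(** A Hamiltonian cycle through a new edge [u v] leaves the spanning path [s]; this closes it again
    without that edge. *)
Lemma ham_diamond u v x y s : irreflexive r -> joined u v x -> joined u v y ->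
  spanning s -> hpath u v s -> r x y ->
  (forall w, r x w -> w != u -> w != v -> covered u v w) ->
  (forall w, r y w -> w != u -> w != v -> covered u v w) -> ham_rel r.
Proof.
move=> rI jx jy sp h xy cx cy.
have xs : x \in s by case: sp.
have ys : y \in s by case: sp.
have nxy : x != y by apply: contraTneq xy => ->; rewrite rI.
case/splitPr: xs sp h ys => s1 s2 sp h; rewrite mem_cat inE eq_sym (negPf nxy) /=.
case/orP => ys; case/splitPr: ys sp h => s3 s4 sp h; last first.
  exact: (ham_diamond_ordered rI jx jy sp h).
rewrite -catA in sp h.
by apply: (ham_diamond_ordered rI jy jx sp h) => //; rewrite rC.
Qed.

(* [p] and [q] may have neighbours [w] missed by both ends; these are common
   neighbours of [p] and [q], and form a clique. *)
Definition near_diamond u v x p q (W : pred T) :=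
  [/\ [/\ r x p, r x q & r p q], [/\ joined u v x, joined u v p & joined u v q],
      forall w, r x w -> w != u -> w != v -> covered u v w,
      forall w, r p w || r q w -> w != u -> w != v -> covered u v w || W w
    & [/\ forall w, W w -> r p w /\ r q w &
       forall w w', W w -> W w' -> w != w' -> r w w']].

Lemma near_diamondC u v x p q W : near_diamond u v x p q W -> near_diamond v u x p q W.
Proof.
case=> h1 [h2 h3 h4] h5 h6 h7; split=> //; first by rewrite !(joinedC v u).
  by move=> w xw wv wu; rewrite coveredC; exact: h5.
by move=> w pw wv wu; rewrite coveredC; exact: h6.
Qed.

Lemma near_diamond_swap u v x p q W : near_diamond u v x p q W -> near_diamond u v x q p W.
Proof.
case=> [[h1 h2 h3]] [h4 h5 h6] h7 h8 [h9 h10]; split=> //.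
- by split=> //; rewrite rC.
- by move=> w; rewrite orbC; exact: h8.
by split=> // w /h9[].
Qed.

Section NearDiamond.
Hypothesis rI : irreflexive r.

Lemma inner_not_end u v c d s1 s2 s3 : spanning (s1 ++ s2 ++ s3) ->
  hpath u c s1 -> hpath d v s3 -> forall w, w \in s2 -> w != u /\ w != v.
Proof.
move=> [us _] h1 h3 w ws; move: us; rewrite !cat_uniq has_cat negb_or.
case/and3P=> _ /andP[/hasPn n1 _] /and3P[_ /hasPn n2 _]; split.
  by apply: contraTneq (mem_hpath_head h1) => <-; exact: n1.
by apply: contraTneq ws => ->; exact: n2 (mem_hpath_last h3).
Qed.

(* Reversing the segment from [p] to the vertex before [q] puts [p] just before [q],
   so that [ham_inner] applies to [x] and [q]. *)
Lemma near_diamond_xpq u v x p q W s1 s2 s3 s4 : near_diamond u v x p q W ->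
  spanning (s1 ++ x :: s2 ++ p :: s3 ++ q :: s4) ->
  hpath u v (s1 ++ x :: s2 ++ p :: s3 ++ q :: s4) -> ham_rel r.
Proof.
move=> [[xp xq pq] [jx jp jq] cx cpq [Wpq WW]] sp h0.
have [//|[c [d [w [g [h1 cx' xd [h2 wp pg h234]]]]]]] := split_pair rI jx jp sp h0 xp.
have [qu qv] := joined_ends rI jq.
have covp := covered_joined jp.
have [[ux vx] [up vp] [uq vq]] : [/\ r u x /\ r v x, r u p /\ r v p & r u q /\ r v q].
  by split; apply/andP.
have cov_s2 z : z \in s2 -> z != u /\ z != v.
  move=> zs; apply: (@inner_not_end u v c g s1 (x :: s2 ++ [:: p]) (s3 ++ q :: s4)) => //.
    by apply: spanning_perm sp; perm_count.
  by rewrite inE mem_cat zs orbT.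
have covd : covered u v d by have [] := cov_s2 d (mem_hpath_head h2); exact: cx.
have [wu wv] := cov_s2 w (mem_hpath_last h2).
have [cw|ncw] := boolP (covered u v w).
  exact: (ham_inner sp h1 cx' xd h2 wp pg h234).
have Ww : W w by have := cpq w; rewrite (negPf ncw) rC wp /=; exact.
have hp2 : hpath d p (s2 ++ [:: p]) by exact: hpath_cat h2 wp (hpath1 _).
have [s3e|s3n] := eqVneq s3 [::].
  subst s3; rewrite cat0s in sp h234.
  case/and3P: (h234) => /eqP gq _ _; subst g.
  case: s4 h234 sp h0 => [/and3P[_ /eqP/= e _]|z s4 h4 sp _]; first by rewrite e eqxx in qv.
  have [e [f [/and3P[_ /= /eqP<- _] qf h5]]] :=
    hpath_catI (s := [:: q]) (t := z :: s4) isT isT h4.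
  have sp' : spanning (s1 ++ x :: (s2 ++ [:: p]) ++ q :: z :: s4) by rewrite -catA.
  exact: (ham_inner sp' h1 cx' xd hp2 pg qf h5).
have [g' [w' [h3 _ _]]] := hpath_catI s3n (isT : q :: s4 != [::]) h234.
have [qg|qg] := eqVneq q g.
  have [us _] := sp; have gs3 := mem_hpath_head h3; exfalso.
  apply: (@uniq_catN q (s1 ++ x :: s2 ++ p :: s3) (q :: s4)); last exact: mem_head.
    by move: us; rewrite -!catA /= -!catA.
  by rewrite qg !(mem_cat, inE) gs3 !orbT.
have [e [h [h3' eq qh h4']]] := hpath_mid h234 qg qv.
have sp' : spanning (s1 ++ x :: (s2 ++ p :: s3) ++ q :: s4) by rewrite -catA.
have hps3 : hpath p e (p :: s3) by rewrite -cat1s; exact: hpath_cat (hpath1 _) pg h3'.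
have hmid : hpath d e (s2 ++ p :: s3) by exact: hpath_cat h2 wp hps3.
have [ce|nce] := boolP (covered u v e).
  exact: (ham_inner sp' h1 cx' xd hmid eq qh h4').
have [eu ev] : e != u /\ e != v.
  apply: (@inner_not_end u v c h s1 (x :: s2 ++ p :: s3 ++ [:: q]) s4) => //.
    by apply: spanning_perm sp; perm_count.
  by rewrite inE !(mem_cat, inE) (mem_hpath_last h3') !orbT.
have We : W e by have := cpq e; rewrite (negPf nce) (rC q) eq orbT /=; exact.
have we : r w e.
  apply: WW => //; apply/negP => /eqP we; subst e.
  have [us _] := sp; move: us; rewrite cat_uniq cons_uniq cat_uniq /= => /and3P[_ _ /andP[_ /and4P[_ hs _ _]]].
  move: hs; rewrite negb_or has_cat negb_or => /and3P[_ /hasPn/(_ _ (mem_hpath_last h3'))].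
  by rewrite /= (mem_hpath_last h2).
have sp2 : spanning (s1 ++ x :: (s2 ++ rev (p :: s3)) ++ q :: s4).
  by apply: spanning_perm sp'; perm_count.
have hmid2 : hpath d p (s2 ++ rev (p :: s3)).
  by apply: hpath_cat h2 we _; exact: hpath_rev hps3.
exact: (ham_inner sp2 h1 cx' xd hmid2 pq qh h4').
Qed.

(** With [x] in the middle, [ham_inner] fails only if the successor [w] of [p] and the predecessor
    [w'] of [q] are both missed by the ends. Then they lie in the clique [W], and the edge [w w']
    opens new routes. *)
Lemma near_diamond_pxq u v x p q W s1 s2 s3 s4 : near_diamond u v x p q W ->
  spanning (s1 ++ p :: s2 ++ x :: s3 ++ q :: s4) ->
  hpath u v (s1 ++ p :: s2 ++ x :: s3 ++ q :: s4) -> ham_rel r.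
Proof.
move=> [[xp xq pq] [jx jp jq] cx cpq [Wpq WW]] sp h0.
have px : r p x by rewrite rC.
have [//|[c [w [e [d [h1 cp pw [h2 ex xd h34]]]]]]] := split_pair rI jp jx sp h0 px.
have [qu qv] := joined_ends rI jq.
have [[ux vx] [up vp] [uq vq]] : [/\ r u x /\ r v x, r u p /\ r v p & r u q /\ r v q].
  by split; apply/andP.
have inner z : z \in s2 -> z != u /\ z != v.
  move=> zs; apply: (@inner_not_end u v c d s1 (p :: s2 ++ [:: x]) (s3 ++ q :: s4)) => //.
    by apply: spanning_perm sp; perm_count.
  by rewrite inE mem_cat zs orbT.
have [wu wv] := inner w (mem_hpath_head h2); have [eu ev] := inner e (mem_hpath_last h2).
have ce : covered u v e by apply: cx => //; rewrite rC.
have [cw|ncw] := boolP (covered u v w).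
  exact: (ham_inner sp h1 cp pw h2 ex xd h34).
have Ww : W w by have := cpq w; rewrite (negPf ncw) pw /=; exact.
have sp' : spanning ((s1 ++ p :: s2) ++ x :: s3 ++ q :: s4) by rewrite -catA.
have h0' : hpath u v ((s1 ++ p :: s2) ++ x :: s3 ++ q :: s4) by rewrite -catA.
have [//|[e' [d' [w' [h [h12 e'x xd' [h3 w'q qh h4]]]]]]] := split_pair rI jx jq sp' h0' xq.
have inner' z : z \in s3 -> z != u /\ z != v.
  move=> zs; apply: (@inner_not_end u v e' h (s1 ++ p :: s2) (x :: s3 ++ [:: q]) s4) => //.
    by apply: spanning_perm sp; perm_count.
  by rewrite inE mem_cat zs orbT.
have [du dv] := inner' d' (mem_hpath_head h3); have [w'u w'v] := inner' w' (mem_hpath_last h3).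
have cd : covered u v d' by exact: cx.
have [cw'|ncw'] := boolP (covered u v w').
  exact: (ham_inner sp' h12 e'x xd' h3 w'q qh h4).
have Ww' : W w' by have := cpq w'; rewrite (negPf ncw') (rC q) w'q orbT /=; exact.
have ww' : r w w'.
  apply: WW => //; apply/negP => /eqP we; subst w'.
  have [us _] := sp; move: us; rewrite cat_uniq cons_uniq cat_uniq /= => /and3P[_ _ /andP[_ /and4P[_ hs _ _]]].
  move: hs; rewrite negb_or has_cat negb_or => /and3P[_ /hasPn/(_ _ (mem_hpath_last h3))].
  by rewrite /= (mem_hpath_head h2).
have hqs4 : hpath q v (q :: s4) by rewrite -cat1s; exact: hpath_cat (hpath1 _) qh h4.
have hps2 : hpath u e (s1 ++ p :: s2).
  by apply: hpath_cat h1 cp _; rewrite -cat1s; exact: hpath_cat (hpath1 _) pw h2.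
have hrest : hpath d' v (s3 ++ q :: s4) by exact: hpath_cat h3 w'q hqs4.
have [ev'|nev] := boolP (r e v).
  apply: (@ham_hpath u x ((s1 ++ p :: s2) ++ rev (s3 ++ q :: s4) ++ [:: x])); last by rewrite rC.
    by apply: spanning_perm sp; perm_count.
  by apply: hpath_cat hps2 ev' _; apply: hpath_cat (hpath_rev hrest) _ (hpath1 _); rewrite rC.
have [du'|ndu] := boolP (r d' u).
  apply: (@ham_hpath u d' ((s1 ++ p :: s2) ++ [:: x] ++ rev (s3 ++ q :: s4))) => //.
    by apply: spanning_perm sp; perm_count.
  by apply: hpath_cat hps2 ex _; apply: hpath_cat (hpath1 _) _ (hpath_rev hrest); rewrite rC.
rewrite /covered (negPf nev) orbF in ce; rewrite /covered (negPf ndu) /= in cd.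
(* Now [e] sees [u] and [d'] sees [v]: the cycle runs from [e] to [w], from [w'] to [d'], from [v]
   to [q], through [x] and [p], and from [c] to [u]. *)
apply: (@ham_hpath e u (rev s2 ++ rev s3 ++ rev (q :: s4) ++ [:: x] ++ [:: p] ++ rev s1)); last by rewrite rC.
  by apply: spanning_perm sp; perm_count.
apply: hpath_cat (hpath_rev h2) ww' _; apply: hpath_cat (hpath_rev h3) cd _.
apply: hpath_cat (hpath_rev hqs4) _ _; first by rewrite rC; exact: xq.
apply: hpath_cat (hpath1 _) xp _.
by apply: hpath_cat (hpath1 _) _ (hpath_rev h1); rewrite rC.
Qed.

(** Up to exchanging [p] with [q] and reversing the path, only two orders remain: [x] before both or
    between them. *)
Lemma ham_near_diamond u v x p q W s : near_diamond u v x p q W ->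
  spanning s -> hpath u v s -> ham_rel r.
Proof.
move=> nd; have nd' := near_diamond_swap nd.
have [[xp xq pq] _ _ _ _] := nd.
have neq a b : r a b -> a != b by move=> ab; apply: contraTneq ab => ->; rewrite rI.
have after s1 s2 u' v' : near_diamond u' v' x p q W -> p \in s2 -> q \in s2 ->
    spanning (s1 ++ x :: s2) -> hpath u' v' (s1 ++ x :: s2) -> ham_rel r.
  move=> {nd nd'} nd; have nd' := near_diamond_swap nd => /splitPr[s3 s4].
  rewrite mem_cat inE eq_sym (negPf (neq _ _ pq)) /= => /orP[/splitPr[s5 s6]|/splitPr[s5 s6]] sp h.
    by rewrite -catA in sp h; exact: (near_diamond_xpq nd' sp h).
  exact: (near_diamond_xpq nd sp h).
move=> sp; have [_ fs] := sp.
have xs := fs x; move=> h; case/splitPr: xs sp fs h => s1 s2 sp fs h.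
have [p1|p2] : p \in s1 \/ p \in s2.
  by have := fs p; rewrite mem_cat inE eq_sym (negPf (neq _ _ xp)) => /orP.
  have [q1|q2] : q \in s1 \/ q \in s2.
    by have := fs q; rewrite mem_cat inE eq_sym (negPf (neq _ _ xq)) => /orP.
    have h' := hpath_rev h; rewrite rev_cat rev_cons -cats1 -catA in h'.
    apply: (after (rev s2) (rev s1) v u (near_diamondC nd)); rewrite ?mem_rev //.
    by apply: spanning_perm sp; perm_count.
  case/splitPr: p1 sp h {fs} => s3 s4; case/splitPr: q2 => s5 s6 sp h.
  by rewrite -catA in sp h; exact: (near_diamond_pxq nd sp h).
have [q1|q2] : q \in s1 \/ q \in s2.
  by have := fs q; rewrite mem_cat inE eq_sym (negPf (neq _ _ xq)) => /orP.
  case/splitPr: q1 sp h {fs} => s3 s4; case/splitPr: p2 => s5 s6 sp h.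
  by rewrite -catA in sp h; exact: (near_diamond_pxq nd' sp h).
exact: (after s1 s2 u v nd).
Qed.

End NearDiamond.

End Paths.

(** * Claw-free closure *)

Section Closure.
Variable T : finType.
Hypothesis T3 : 2 < #|T|.
Implicit Types r F : rel T.

Definition clawless r := forall x a b c, r x a -> r x b -> r x c ->
  a != b -> a != c -> b != c -> [|| r a b, r a c | r b c].

Definition diamondless r := forall x y u v, r x y -> r x u -> r x v ->
  r y u -> r y v -> u != v -> r u v.

Definition add_edge r u v : rel T :=
  fun a b => [|| r a b, (a == u) && (b == v) | (a == v) && (b == u)].

Lemma add_edge_sym r u v : symmetric r -> symmetric (add_edge r u v).
Proof.
by move=> rC a b; rewrite /add_edge rC; case: (r b a) => //=; rewrite orbC andbC (andbC (b == v)).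
Qed.

(** Once the cycle is rotated to start at [u], only its first or last step can be the new edge. *)
Lemma ham_add_edge r u v : symmetric r -> irreflexive r -> u != v ->
  ham_rel (add_edge r u v) -> ham_rel r \/ exists s, spanning s /\ hpath r u v s.
Proof.
move=> rC rI uv [c [sc /andP[cyc uc] fc]].
have [i t ct] := rot_to (fc u).
have ut : uniq (u :: t) by rewrite -ct rot_uniq.
have ft x : x \in u :: t by rewrite -ct mem_rot.
have cyt : cycle (add_edge r u v) (u :: t) by rewrite -ct rot_cycle.
have st : 2 < size (u :: t) by rewrite -ct size_rot.
case: t ct ut ft cyt st => [|a t] // _ ut ft; rewrite /= rcons_path => /and3P[ua pt lu] st.
move: (ut) => /= /andP[nut /andP[nat_ _]].
have pt' : path r a t.
  rewrite (eq_in_path (P := [pred z | z != u]) (e' := add_edge r u v)) // => [z w|].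
    by rewrite !inE /add_edge => /negPf-> /negPf->; rewrite andbF !orbF.
  apply/allP => z zs; rewrite inE; apply: contraNneq nut => <-; exact: zs.
have au : a != u by apply: contraNneq nut => ->; rewrite mem_head.
have lt : last a t \in a :: t by exact: mem_last.
have lnu : last a t != u by apply: contraNneq nut => <-.
have [rua|nrua] := boolP (r u a).
  have [rlu|nrlu] := boolP (r (last a t) u).
    left; exists (u :: a :: t); split => //.
    by rewrite /ucycle ut andbT /= rcons_path rua pt' rlu.
  right; exists (u :: a :: t); split; first by split.
  move: lu; rewrite /add_edge (negPf nrlu) (negPf lnu) /= eqxx andbT => /eqP lv.
  by apply/and3P; split; rewrite /= ?lv ?rua.
right; exists (rev (rcons (a :: t) u)); split.
  apply: (@spanning_perm _ (u :: a :: t)) => //.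
  by rewrite -cats1; perm_count.
apply: hpath_rev => //.
move: ua; rewrite /add_edge (negPf nrua) eqxx (negPf au) andbF orbF /= => /eqP av.
rewrite /= av eqxx last_rcons eqxx rcons_path -av pt' /=.
move: lu; rewrite /add_edge (negPf lnu) /= => /orP[//|/andP[/eqP lv _]].
move: lv nat_ st; rewrite -av; case: (t) => // z t' /= <-.
by rewrite mem_last.
Qed.

Section Completion.
Variables (r : rel T) (x : T).
Hypotheses (rC : symmetric r) (rI : irreflexive r) (rcf : clawless r).

Definition completion : rel T := fun a b => r a b || [&& a != b, r x a & r x b].

Lemma completion_sym : symmetric completion.
Proof. by move=> a b; rewrite /completion rC eq_sym (andbC (r x a)). Qed.

Lemma completion_irr : irreflexive completion.
Proof. by move=> a; rewrite /completion rI eqxx. Qed.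

(** If a claw at [z] uses a new edge [z a], then [x] is adjacent to [z] and [a], hence not to the
    other leaves [b] and [c], which would otherwise be joined to [a]. So [z] with leaves [x], [b],
    [c] was a claw before. *)
Lemma completion_clawless : clawless completion.
Proof.
move=> z a b c za zb zc ab ac bc.
apply/negPn/negP => /norP[nab /norP[nac nbc]].
have old a' b' c' : completion z a' -> completion z b' -> completion z c' ->
    a' != b' -> a' != c' -> b' != c' -> ~~ completion a' b' ->
    ~~ completion a' c' -> ~~ completion b' c' -> r z a'.
  move=> za' zb' zc' ab' ac' bc'; rewrite /completion !negb_or ab' ac' bc' /=.
  move=> /andP[rab xab] /andP[rac xac] /andP[rbc xbc]; apply/negPn/negP => nza.
  move: za'; rewrite /completion (negPf nza) /= => /and3P[_ xz xa].
  rewrite xa /= in xab xac.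
  move: zb' zc'; rewrite /completion (negPf xab) (negPf xac) !andbF !orbF => zb' zc'.
  have xnb : x != b' by apply: contraNneq rab => <-; rewrite rC.
  have xnc : x != c' by apply: contraNneq rac => <-; rewrite rC.
  have := rcf (x := z) (a := x) (b := b') (c := c').
  by rewrite rC xz zb' zc' xnb xnc bc' (negPf xab) (negPf xac) (negPf rbc) => /(_ isT isT isT isT isT isT).
have ra : r z a by exact: old za zb zc ab ac bc nab nac nbc.
have rb : r z b by apply: (old b a c) => //; rewrite 1?eq_sym 1?completion_sym.
have rc : r z c.
  by apply: (old c a b) => //; rewrite 1?eq_sym 1?completion_sym.
have := rcf ra rb rc ab ac bc.
by move: nab nac nbc; rewrite /completion !negb_or => /andP[/negPf-> _] /andP[/negPf-> _] /andP[/negPf-> _].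
Qed.

Hypotheses (c a0 b0 : T).
Hypotheses (xc : r x c) (xa0 : r x a0) (xb0 : r x b0) (ca0 : r c a0) (cb0 : r c b0).
Hypotheses (ab0 : a0 != b0) (nab0 : ~~ r a0 b0).

Lemma nbr_cover u v w : r x u -> r x v -> r x w -> u != v -> w != u -> w != v ->
  ~~ r u v -> r w u || r w v.
Proof.
move=> xu xv xw uv wu wv nuv; have := rcf xu xv xw.
by rewrite uv (eq_sym u) (eq_sym v) wu wv (negPf nuv) /= (rC w u) (rC w v); exact.
Qed.

(* Pairs with a common neighbour inside the neighbourhood of [x] are joined first.
   A pair [u], [v] missing after that splits the neighbourhood into the cliques [A]
   around [u] and [B] around [v], and an edge [p q] between them gives a near-diamond. *)
Lemma ham_completion_step F u v : symmetric F -> subrel r F -> subrel F completion ->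
  completion u v -> ~~ F u v ->
  (forall a b y, r x a -> r x b -> r x y -> r y a -> r y b -> a != b -> F a b) \/
    (exists2 y, r x y & r y u && r y v) ->
  ham_rel (add_edge F u v) -> ham_rel F.
Proof.
move=> FC rF Fx cuv nF choice hF.
have FI : irreflexive F by move=> z; apply/negP => /Fx; rewrite completion_irr.
have nr : ~~ r u v by apply: contra nF; exact: rF.
move: (cuv); rewrite /completion (negPf nr) /= => /and3P[uv xu xv].
have [//|[s [sp hp]]] := ham_add_edge FC FI uv hF.
have nr' : ~~ r v u by rewrite rC.
have covx w : F x w -> w != u -> w != v -> covered F u v w.
  move=> /Fx; rewrite /completion rI andbF orbF => xw wu wv.
  by have /orP[|] := nbr_cover xu xv xw uv wu wv nr => /rF; rewrite /covered => ->; rewrite ?orbT.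
have jx : joined F u v x by rewrite /joined !(FC _ x) !rF.
have Fold y w : r x y -> F y w -> r x w \/ r y w.
  by move=> xy /Fx /orP[|/and3P[_ _]]; [right | left].
case: choice => [full|[y xy /andP[yu yv]]]; last first.
  have jy : joined F u v y by rewrite /joined !(FC _ y) !rF.
  apply: (@ham_diamond _ F FC T3 u v x y s) => //; first exact: rF.
  move=> w yw wu wv; have [xw|ryw] := Fold y w xy yw; first by apply: covx => //; exact: rF.
  have := rcf yu yv ryw; rewrite uv (eq_sym u) (eq_sym v) wu wv (negPf nr) /= => /(_ isT isT isT).
  by rewrite /covered; case/orP => /rF; rewrite FC => ->; rewrite ?orbT.
pose A w := (w == u) || r u w; pose B w := (w == v) || r v w.
have AB w : r x w -> A w || B w.
  move=> xw; rewrite /A /B; have [//|wu] := eqVneq w u; have [|wv] := eqVneq w v.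
    by rewrite orbT.
  by rewrite /= !(rC _ w); exact: nbr_cover xu xv xw uv wu wv nr.
(* A common neighbour of [u] and [v] near [x] would have put the pair into [F] by [full]. *)
have nAB w : r x w -> A w -> B w -> False.
  move=> xw /orP[/eqP->|uw] /orP[/eqP e|vw].
  - by rewrite e eqxx in uv.
  - by rewrite rC (negPf nr) in vw.
  - by rewrite e (negPf nr) in uw.
  by move: nF; rewrite (full u v w) // rC.
have Acl w w' : r x w -> r x w' -> A w -> A w' -> w != w' -> r w w'.
  move=> xw xw' /orP[/eqP->|uw] /orP[/eqP->|uw'] //; first by rewrite eqxx.
    by move=> _; rewrite rC.
  move=> ww'; have nv z : r x z -> r u z -> (z != v) && ~~ r z v.
    move=> xz uz; apply/andP; split; first by apply: contraTneq uz => ->.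
    by apply/negP => zv; apply: (nAB z) => //; rewrite /A /B ?uz ?(rC v) ?zv orbT.
  have /andP[wv nwv] := nv _ xw uw; have /andP[w'v nw'v] := nv _ xw' uw'.
  by have := rcf xw xw' xv ww' wv w'v; rewrite (negPf nwv) (negPf nw'v) !orbF.
have Bcl w w' : r x w -> r x w' -> B w -> B w' -> w != w' -> r w w'.
  move=> xw xw' /orP[/eqP->|uw] /orP[/eqP->|uw'] //; first by rewrite eqxx.
    by move=> _; rewrite rC.
  move=> ww'; have nv z : r x z -> r v z -> (z != u) && ~~ r z u.
    move=> xz uz; apply/andP; split; first by apply: contraTneq uz => ->.
    by apply/negP => zv; apply: (nAB z) => //; rewrite /A /B ?uz ?(rC u) ?zv orbT.
  have /andP[wv nwv] := nv _ xw uw; have /andP[w'v nw'v] := nv _ xw' uw'.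
  by have := rcf xw xw' xu ww' wv w'v; rewrite (negPf nwv) (negPf nw'v) !orbF.
(* The path [a0 c b0] has nonadjacent ends, so it does not stay within one clique and one of its
   edges crosses. *)
have [p [q [[xp xq pq] [Ap Bq]]]] : exists p q, [/\ r x p, r x q & r p q] /\ A p /\ B q.
  have cross a b : r x a -> r x b -> r c a -> r c b -> A a -> B b ->
      exists p q, [/\ r x p, r x q & r p q] /\ A p /\ B q.
    move=> xa xb ca cb Aa Bb; case/orP: (AB _ xc) => [Ac|Bc].
      by exists c, b.
    by exists a, c; split=> //; split=> //; rewrite rC.
  case/orP: (AB _ xa0) (AB _ xb0) => [Aa|Ba] /orP[Ab|Bb].
  - by move: nab0; rewrite (Acl a0 b0).
  - exact: (cross a0 b0).
  - exact: (cross b0 a0).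
  - by move: nab0; rewrite (Bcl a0 b0).
have pu : p != u.
  apply/negP => /eqP pu; subst p; apply: (nAB q) => //.
  by rewrite /A pq orbT.
have qv : q != v.
  apply/negP => /eqP qv; subst q; apply: (nAB p) => //.
  by rewrite /B rC pq orbT.
have up : r u p by case/orP: Ap => //; rewrite (negPf pu).
have vq : r v q by case/orP: Bq => //; rewrite (negPf qv).
have fullp y : r x y -> y != p -> F y p.
  move=> xy yp; case/orP: (AB _ xy) => [Ay|By]; first by apply/rF/Acl.
  have [->|yq] := eqVneq y q; first by apply: rF; rewrite rC.
  by apply: (full y p q); rewrite // rC ?pq //; exact: Bcl.
have fullq y : r x y -> y != q -> F y q.
  move=> xy yq; case/orP: (AB _ xy) => [Ay|By]; last by apply/rF/Bcl.
  have [->|yp] := eqVneq y p; first by exact: rF.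
  by apply: (full y q p); rewrite // rC //; exact: Acl.
have pv : p != v by apply: contraTneq up => ->.
have qu : q != u by apply: contraTneq vq => ->.
have nuq : ~~ r u q by apply/negP => h; apply: (nAB q) => //; rewrite /A h orbT.
have nvp : ~~ r v p by apply/negP => h; apply: (nAB p) => //; rewrite /B h orbT.
(* A neighbour [w] of [p] missed by [u] and [v] is neither [x] nor adjacent to [x]; the claw at [p]
   with leaves [u], [q], [w] forces the edge [q w], and likewise at [q] with [v], [p], [w]. The claw
   at [p] with leaves [x], [w], [w'] makes [W] a clique. *)
pose W w := [&& r p w, r q w, ~~ r x w & w != x].
apply: (@ham_near_diamond _ F FC T3 FI u v x p q W s) => //; split=> //.
- by split; apply: rF.
- split=> //; apply/andP; split.
  + by apply: fullp => //; rewrite eq_sym.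
  + by apply: fullp => //; rewrite eq_sym.
  + by apply: fullq => //; rewrite eq_sym.
  by apply: fullq => //; rewrite eq_sym.
- move=> w pqw wu wv; have [xw|nxw] := boolP (r x w).
    by apply/orP; left; apply: covx => //; exact: rF.
  have [->|wx] := eqVneq w x; first by rewrite /covered rF // rC.
  rewrite /W nxw wx !andbT; apply/orP.
  have [cw|ncw] := boolP (covered F u v w); first by left.
  right; case/norP: ncw => nwu nwv.
  have {}nwu : ~~ r u w by apply: contra nwu => h; rewrite FC; exact: rF.
  have {}nwv : ~~ r v w by apply: contra nwv => h; rewrite FC; exact: rF.
  have wp : w != p by apply: contraNneq nxw => ->.
  have wq : w != q by apply: contraNneq nxw => ->.
  case/orP: pqw => [Fpw|Fqw].
    have [xw|pw] := Fold p w xp Fpw; first by rewrite xw in nxw.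
    have := rcf (x := p) (a := u) (b := q) (c := w).
    rewrite rC up pq pw eq_sym qu eq_sym wu eq_sym wq (negPf nuq) (negPf nwu) /=.
    by apply.
  have [xw|qw] := Fold q w xq Fqw; first by rewrite xw in nxw.
  have := rcf (x := q) (a := v) (b := p) (c := w).
  rewrite rC vq (rC q) pq qw eq_sym pv eq_sym wv eq_sym wp (negPf nvp) (negPf nwv) /= andbT.
  by apply.
split=> [w /and4P[pw qw _ _]|w w' /and4P[pw _ nxw wx] /and4P[pw' _ nxw' wx'] ww'].
  by split; exact: rF.
apply: rF; have := rcf (x := p) (a := x) (b := w) (c := w').
by rewrite rC xp pw pw' (eq_sym x) wx (eq_sym x) wx' ww' (negPf nxw) (negPf nxw') => /(_ isT isT isT isT isT isT).
Qed.

Lemma ham_completion : ham_rel completion -> ham_rel r.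
Proof.
move=> hc.
(* Induction over the graphs between [r] and its completion; [k] bounds the number of pairs still
   missing. *)
have gen k F : symmetric F -> subrel r F -> subrel F completion ->
    #|[pred e : T * T | completion e.1 e.2 && ~~ F e.1 e.2]| <= k -> ham_rel F.
  elim: k F => [|k IH] F FC rF Fx; [rewrite leqn0 => /eqP/card0_eq|] => cF.
    case: hc => s [s3 /andP[cs us] fs]; exists s; split=> //.
    rewrite /ucycle us andbT; apply: sub_cycle cs => a b ab.
    by have := cF (a, b); rewrite !inE /= ab /= => /negbFE.
  have [/forallP all|/forallPn[[u v] /=]] :=
    boolP [forall e : T * T, completion e.1 e.2 ==> F e.1 e.2].
    case: hc => s [s3 /andP[cs us] fs]; exists s; split=> //.
    rewrite /ucycle us andbT; apply: sub_cycle cs => a b ab.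
    by have := all (a, b); rewrite /= ab.
  have step a b : completion a b -> ~~ F a b -> ham_rel (add_edge F a b).
    move=> cab nab; apply: IH; first exact: add_edge_sym.
    - by move=> z w /rF; rewrite /add_edge => ->.
    - move=> z w /or3P[/Fx//|/andP[/eqP-> /eqP->]//|/andP[/eqP-> /eqP->]].
      by rewrite completion_sym.
    rewrite -ltnS; apply: leq_trans cF; apply: proper_card; apply/properP; split.
      by apply/subsetP => e; rewrite !inE /add_edge !negb_or => /andP[-> /andP[->]].
    by exists (a, b); rewrite !inE /add_edge /= ?cab ?nab ?eqxx ?orbT.
  have [/existsP[[[a b] y] /= /and5P[xa xb xy ya /and3P[yb ab nF]]] _|/existsPn none] :=
    boolP [exists e : T * T * T, [&& r x e.1.1, r x e.1.2, r x e.2, r e.2 e.1.1 &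
       [&& r e.2 e.1.2, e.1.1 != e.1.2 & ~~ F e.1.1 e.1.2]]].
    have cab : completion a b by rewrite /completion ab xa xb orbT.
    apply: (@ham_completion_step F a b) => //; last exact: step.
    by right; exists y; rewrite ?ya.
  rewrite negb_imply => /andP[cuv nuv].
  apply: (@ham_completion_step F u v) => //; last exact: step.
  left=> a b y xa xb xy ya yb ab; have := none (a, b, y).
  by rewrite /= xa xb xy ya yb ab /= negbK.
apply: (gen _ r rC _ _ (leqnn _)) => // a b ab.
by rewrite /completion ab.
Qed.

End Completion.

(** A diamond puts the path [u y v] with nonadjacent ends into the neighbourhood of [x], exactly the
    data [ham_completion] asks for. Completing there adds the pair [u v], so the iteration ends, and
    it can only end without diamonds. *)
Lemma claw_free_closure r : symmetric r -> irreflexive r -> clawless r ->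
  exists F, [/\ symmetric F, irreflexive F, subrel r F, clawless F
    & diamondless F /\ (ham_rel F -> ham_rel r)].
Proof.
have [k] := ubnP #|[pred e : T * T | ~~ r e.1 e.2]|.
elim: k r => // k IH r; rewrite ltnS => cr rC rI rcf.
pose dia (e : T * T * (T * T)) := let: (x, y, (u, v)) := e in
  [&& r x y, r x u, r x v, r y u & [&& r y v, u != v & ~~ r u v]].
have [/existsP[[[x y] [u v]]]|/existsPn none] := boolP [exists e, dia e].
  move=> /and5P[xy xu xv yu /and3P[yv uv nuv]].
  have sub : subrel r (completion r x) by move=> a b; rewrite /completion => ->.
  have [||||F [FC FI rF Fcf [Fd Fh]]] := IH (completion r x).
  - apply: leq_trans cr; apply: proper_card; apply/properP; split.
      by apply/subsetP => e; rewrite !inE; apply: contra; exact: sub.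
    by exists (u, v); rewrite !inE /completion //= negbK uv xu xv orbT.
  - exact: completion_sym.
  - exact: completion_irr.
  - exact: completion_clawless.
  exists F; split=> //; first by move=> a b /sub /rF.
  split=> // /Fh; exact: (@ham_completion r x rC rI rcf y u v).
exists r; split=> //; split=> // x y u v xy xu xv yu yv uv.
by have := none (x, y, (u, v)); rewrite /dia xy xu xv yu yv uv /= negbK.
Qed.

End Closure.

(** * Search over the vertices outside a clique *)

(* Call-by-value evaluation computes both arguments of [&&], [||] and hence all
   of [all] and [has]; these variants stop early. *)
Fixpoint allc (I : Type) (p : I -> bool) (s : seq I) : bool :=
  if s is x :: s' then (if p x then allc p s' else false) else true.

Fixpoint hasc (I : Type) (p : I -> bool) (s : seq I) : bool :=
  if s is x :: s' then (if p x then true else hasc p s') else false.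

(* Each vertex carries its adjacency to the later entries and the class of its
   neighbour in the clique, 0 when it has none. *)
Definition config := seq (seq bool * nat).

Fixpoint cadj (c : config) i j : bool :=
  match c, i, j with
  | (row, _) :: _, 0, j'.+1 => nth false row j'
  | (row, _) :: _, i'.+1, 0 => nth false row i'
  | _ :: c', i'.+1, j'.+1 => cadj c' i' j'
  | _, _, _ => false
  end.

Definition catt (c : config) i := (nth ([::], 0) c i).2.

Definition matrix_of (c : config) : seq (seq bool) :=
  let V := iota 0 (size c) in [seq [seq cadj c i j | j <- V] | i <- V].

Definition look (M : seq (seq bool)) i j := nth false (nth [::] M i) j.

Section Check.
Variables (V : seq nat) (A : rel nat) (t : nat -> nat).

(** Necessary conditions for a claw-free graph without diamonds, restricted to those that involve
    the newest vertex 0; the rest were tested when their own newest vertex was added. The tests on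
    [t] are claws and diamonds that contain clique vertices. *)
Definition head_ok : bool :=
  let N := [seq i <- V | A 0 i] in
  let F := [seq i <- V | (i != 0) && ~~ A 0 i] in
  let pair b c :=
    if b == c then true else
    if A b c then
      if allc (fun z => if A z b then ~~ A z c else true) F then
      if allc (fun z => if A b z then (z == c) || A c z else true) N then
      ((t 0 == 0) || (t b != t 0) || (t c == t 0)) &&
      ((t b == 0) || (t b != t c) || (t b == t 0))
      else false else false
    else
      if (t 0 == 0) || (t b == t 0) || (t c == t 0) then
        allc (fun z => [|| z == b, z == c, A b z | A c z]) N
      else false in
  let leaf x b :=
    if A x b then
      if (t x == 0) || (t x == t 0) || (t b == t x) then
        allc (fun c => if A x c then (c == b) || A b c else true) F
      else false
    else true in
  if allc (fun b => (t b == 0) || (t b != t 0)) F then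
    if allc (fun b => allc (pair b) N) N then allc (fun x => allc (leaf x) F) N else false
  else false.

(* Can [rem] be covered by disjoint paths whose ends attach to pairwise distinct
   clique vertices, outside [used]?  [cur] is the last vertex of an open path. *)
Fixpoint path_cover fuel (rem : seq nat) (cur : option nat) (used : seq nat) : bool :=
  if fuel is f.+1 then
    if cur is Some x then
      if (if (t x != 0) && (t x \notin used) then path_cover f rem None (t x :: used) else false)
      then true
      else hasc (fun h => if A x h then path_cover f (filter (predC1 h) rem) (Some h) used else false) rem
    else
      if nilp rem then true
      else hasc (fun h => if (t h != 0) && (t h \notin used) then
             path_cover f (filter (predC1 h) rem) (Some h) (t h :: used) else false) rem
  else false.

(** The summands count the boundary of [S]: the other outside vertices adjacent to it and the clique
    vertices it is attached to. *)
Definition weakly_attached (S : seq nat) : bool :=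
  size [seq i <- V | if i \in S then false else hasc (A i) S]
    + size (undup [seq k <- map t S | k != 0]) <= 1.

(* No two-connected graph passes this test. *)
Definition separated : bool :=
  hasc (fun S => if nilp S then false else weakly_attached S)
    (foldr (fun i l => l ++ map (cons i) l) [:: [::]] V).

(* 0, 1, 2, 3, 4, 5 stand for a2, a3, b2, b3, c2, c3. *)
Definition ep_edges : seq (nat * nat) :=
  [:: (0, 1); (2, 3); (0, 2); (0, 4); (2, 4); (1, 3); (1, 5); (3, 5)].

Definition ep_like (s : seq nat) : bool :=
  let p := nth 0 s in
  [&& t (p 0) != 0, t (p 1) == t (p 0), t (p 2) != 0, t (p 3) == t (p 2),
      t (p 2) != t (p 0), t (p 4) == 0, t (p 5) == 0 &
      all (fun i => all (fun j =>
        A (p i) (p j) == ((i, j) \in ep_edges) || ((j, i) \in ep_edges))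
        (iota 0 6)) (iota 0 6)].

Definition edge_count : nat :=
  sumn [seq count (A i) V | i <- V].

End Check.

(** Vertices are listed by nonincreasing class, which leaves positions 0, 1 to [a2], [a3], then 2, 3
    to the [b]'s and 4, 5 to the unattached [c]'s. The symmetry of EP' exchanging the indices 2 and
    3 fixes the order of the [a]'s. *)
Definition ep_orders : seq (seq nat) :=
  [:: [:: 0; 1; 2; 3; 4; 5]; [:: 0; 1; 3; 2; 4; 5];
      [:: 0; 1; 2; 3; 5; 4]; [:: 0; 1; 3; 2; 5; 4]].

(* [edge_count] counts every edge twice. *)
Definition leaf_ok (c : config) (M : seq (seq bool)) : bool :=
  let m := size c in
  let V := iota 0 m in
  let A := look M in
  let t := catt c in
  if (if m == 6 then edge_count V A <= 14 else false) then true else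
  if path_cover A t (2 * m).+1 V None [::] then true else
  if separated V A t then true else
  if m == 6 then hasc (ep_like A t) ep_orders else false.

Fixpoint rows m : seq (seq bool) :=
  if m is m'.+1 then [seq true :: r | r <- rows m'] ++ [seq false :: r | r <- rows m']
  else [:: [::]].

Definition last_att (c : config) := if c is (_, a) :: _ then a else 0.

(* Vertices are added by nondecreasing attachment class, without gaps. *)
Fixpoint search fuel (c : config) : bool :=
  let M := matrix_of c in
  if head_ok (iota 0 (size c)) (look M) (catt c) then
    if leaf_ok c M then
      if fuel is f.+1 then
        allc (fun a => allc (fun r => search f ((r, a) :: c)) (rows (size c)))
          [:: last_att c; (last_att c).+1]
      else true
    else false
  else true.

Lemma allcE (I : Type) (p : pred I) s : allc p s = all p s.
Proof. by elim: s => //= x s ->; case: (p x). Qed.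

Lemma hascE (I : Type) (p : pred I) s : hasc p s = has p s.
Proof. by elim: s => //= x s ->; case: (p x). Qed.

(** Six is the number of vertices that may lie outside the clique. The virtual machine evaluates the
    search when the proof is checked at [Qed]. *)
Lemma search_complete : search 6 [::].
Proof. by vm_cast_no_check (erefl true). Qed.

(** * Soundness of the path cover test *)

Section CoverSound.
Variables (A : rel nat) (t : nat -> nat).

Definition good_path (p : seq nat) :=
  if p is x :: q then [&& path A x q, t x != 0 & t (last x q) != 0] else false.

Definition path_ends (p : seq nat) := [:: t (head 0 p); t (last 0 p)].

Lemma perm_rem_filter (h : nat) rem s : uniq rem -> h \in rem ->
  perm_eq s [seq x <- rem | predC1 h x] -> perm_eq (h :: s) rem.
Proof.
move=> ur hr ps; rewrite perm_sym.
by apply: (perm_trans (perm_to_rem hr)); rewrite perm_cons rem_filter // perm_sym.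
Qed.

(** For an open path only the continuation [q] after [x] is produced, as its first end already sits
    in [used]. Uniqueness of the ends excludes one-vertex paths, whose two ends would share a clique
    vertex. *)
Lemma cover_sound fuel rem cur used : uniq rem -> uniq used ->
  path_cover A t fuel rem cur used ->
  if cur is Some x then
    exists q ps, [/\ perm_eq (q ++ flatten ps) rem, path A x q, t (last x q) != 0,
      all good_path ps & uniq (t (last x q) :: flatten (map path_ends ps) ++ used)]
  else
    exists ps, [/\ perm_eq (flatten ps) rem, all good_path ps &
      uniq (flatten (map path_ends ps) ++ used)].
Proof.
elim: fuel rem cur used => // f IH rem [x|] used ur uu /=.
  case: ifP => [+ _|_].
    case: ifP => // /andP[tx nu] /IH[//||ps [p1 g1 u1]]; first by rewrite /= nu.
    exists [::], ps; split=> //=.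
    by rewrite -cat1s uniq_catCA in u1.
  rewrite hascE => /hasP[h hr]; case: ifP => // xh /IH[||q [ps [p1 pq tl g1 u1]]] //.
    exact: filter_uniq.
  exists (h :: q), ps; split=> //=; last by rewrite xh.
  exact: perm_rem_filter.
case: ifP => [/nilP-> _|_]; first by exists [::].
rewrite hascE => /hasP[h hr]; case: ifP => // /andP[th nu] /IH[||q [ps [p1 pq tl g1 u1]]] //.
- exact: filter_uniq.
- by rewrite /= nu.
exists ((h :: q) :: ps); split=> //=.
- exact: perm_rem_filter.
- by rewrite pq th tl.
have pe : perm_eq (t (last h q) :: flatten (map path_ends ps) ++ t h :: used)
    (t h :: t (last h q) :: flatten (map path_ends ps) ++ used) by perm_count.
by have := u1; rewrite -[X in is_true X -> _]/(uniq (t (last h q) :: flatten (map path_ends ps) ++ t h :: used)) (perm_uniq pe).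
Qed.

End CoverSound.

Lemma mem_sublists (V : seq nat) S :
  S \in foldr (fun i l => l ++ map (cons i) l) [:: [::]] V -> {subset S <= V}.
Proof.
elim: V S => [|v V IH] S /=; first by rewrite inE => /eqP->.
rewrite mem_cat => /orP[/IH sub x /sub xV|/mapP[S' /IH sub ->] x].
  by rewrite inE xV orbT.
by rewrite !inE => /orP[->//|/sub->]; rewrite orbT.
Qed.

Lemma mem_rows r : r \in rows (size r).
Proof.
elim: r => //= b r IH; rewrite mem_cat; case: b.
  by rewrite map_f.
by rewrite (map_f (cons false)) // orbT.
Qed.

(** * Graphs with a large clique as configurations of the search *)

Section Transfer.
Variables (T : finType) (F : rel T) (K : {set T}).
Hypotheses (FC : symmetric F) (FI : irreflexive F).
Hypotheses (Fcf : clawless F) (Fdf : diamondless F).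
Hypothesis Kcl : {in K &, forall x y, x != y -> F x y}.
Hypothesis K1 : forall u, u \notin K -> {in K &, forall k k', F u k -> F u k' -> k = k'}.

Definition feet : seq T := [seq k <- enum K | [exists u, (u \notin K) && F u k]].

Lemma mem_feet k : (k \in feet) = (k \in K) && [exists u, (u \notin K) && F u k].
Proof. by rewrite mem_filter mem_enum andbC. Qed.

Lemma feet_uniq : uniq feet.
Proof. by rewrite filter_uniq // enum_uniq. Qed.

(** Numbering only the clique vertices that have outside neighbours leaves no gaps between the
    classes in use, as [search] requires. *)
Definition att u : nat := if has (F u) feet then (find (F u) feet).+1 else 0.

(** Meaningful only if [att u] is nonzero; the default [u] is then never returned. *)
Definition foot u : T := nth u feet (att u).-1.

Lemma footP u : att u != 0 -> foot u \in K /\ F u (foot u).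
Proof.
rewrite /att /foot; case: ifP => //= hf _; split; last by rewrite /att hf; exact: nth_find.
by have : nth u feet (find (F u) feet) \in feet; [rewrite mem_nth // -has_find |
   rewrite /att hf mem_feet => /andP[]].
Qed.

Lemma att0P u k : u \notin K -> k \in K -> F u k -> att u != 0 /\ foot u = k.
Proof.
move=> uK kK uk; have a0 : att u != 0.
  rewrite /att; case: hasP => // -[]; exists k => //.
  by rewrite mem_feet kK; apply/existsP; exists u; rewrite uK.
by split=> //; have [fK uf] := footP a0; exact: (K1 uK fK kK uf uk).
Qed.

Lemma foot_inj u v : att u != 0 -> att v != 0 -> (foot u == foot v) = (att u == att v).
Proof.
have lt w : att w != 0 -> (att w).-1 < size feet.
  by rewrite /att; case: ifP => //=; rewrite has_find.
move=> a0 b0; rewrite /foot (set_nth_default v u (lt _ a0)) nth_uniq ?lt ?feet_uniq //.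
by move: a0 b0; case: (att u) (att v) => [|a] [|b].
Qed.

Lemma foot_eq u v : att u != 0 -> att u = att v -> foot u = foot v.
Proof. by move=> a0 e; apply/eqP; rewrite foot_inj ?e // -e. Qed.

Lemma adj_foot u v : v \notin K -> att u != 0 -> F v (foot u) -> att v = att u.
Proof.
move=> vK a0 h; have [fK _] := footP a0; have [b0 e] := att0P vK fK h.
by apply/eqP; rewrite -foot_inj // e.
Qed.

Variable g : T.
Hypotheses (gK : g \in K) (gfar : forall u, u \notin K -> ~~ F u g).

(** Otherwise [u], [v] and [g] would be the leaves of a claw at the common foot; hence the wish for
    a clique vertex without outside neighbours. *)
Lemma att_clique u v : u \notin K -> v \notin K -> att u != 0 -> att u = att v ->
  u != v -> F u v.
Proof.
move=> uK vK a0 e uv; have [fK uf] := footP a0.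
have vf : F v (foot u).
  by rewrite (foot_eq a0 e); have [] := @footP v; rewrite -?e.
have fg : F (foot u) g.
  by apply: Kcl => //; apply: contraNneq (gfar uK) => <-.
have := Fcf (x := foot u) (a := u) (b := v) (c := g).
rewrite FC uf (FC _ v) vf fg uv (negPf (gfar uK)) (negPf (gfar vK)) !orbF; apply=> //.
  by apply: contraNneq uK => ->.
by apply: contraNneq vK => ->.
Qed.

(** Both [c] and the common foot of [u] and [b] are adjacent to the two ends of the edge [u b], and
    there are no diamonds. *)
Lemma att_triangle u b c : b \notin K -> c \notin K -> u \notin K ->
  F u b -> F u c -> F b c -> att u != 0 -> att b = att u -> att c = att u.
Proof.
move=> bK cK uK ub uc bc a0 e; have [fK uf] := footP a0.
apply: adj_foot => //.
have bf : F b (foot u) by rewrite -(foot_eq _ e) ?e //; have [] := @footP b; rewrite ?e.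
by apply: (Fdf ub) => //; apply: contraNneq cK => ->.
Qed.

(** The foot of [u] is the third leaf, so it must be adjacent to [b] or [c]. *)
Lemma att_claw u b c : b \notin K -> c \notin K -> b != c -> F u b -> F u c -> ~~ F b c ->
  att u != 0 -> (att b == att u) || (att c == att u).
Proof.
move=> bK cK nbc ub uc bc a0; have [fK uf] := footP a0.
have := Fcf ub uc uf nbc; rewrite (negPf bc) /= => /(_ _ _)/orP[||h|h].
- by apply: contraNneq bK => ->.
- by apply: contraNneq cK => ->.
- by rewrite (adj_foot bK a0 h) eqxx.
by rewrite (adj_foot cK a0 h) eqxx orbT.
Qed.

Fixpoint cfg (s : seq T) : config :=
  if s is u :: s' then (map (F u) s', att u) :: cfg s' else [::].

Lemma size_cfg s : size (cfg s) = size s.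
Proof. by elim: s => //= u s ->. Qed.

Lemma cadj_cfg x0 s i j : i < size s -> j < size s ->
  cadj (cfg s) i j = F (nth x0 s i) (nth x0 s j).
Proof.
elim: s i j => // u s IH [|i] [|j] /= si sj; first by rewrite FI.
- by rewrite (nth_map x0).
- by rewrite (nth_map x0) // FC.
exact: IH.
Qed.

Lemma catt_cfg x0 s i : i < size s -> catt (cfg s) i = att (nth x0 s i).
Proof. by elim: s i => // u s IH [|i] //= si; exact: IH. Qed.

Lemma look_cfg x0 s i j : i < size s -> j < size s ->
  look (matrix_of (cfg s)) i j = F (nth x0 s i) (nth x0 s j).
Proof.
move=> si sj; rewrite -cadj_cfg // /look /matrix_of size_cfg.
rewrite (nth_map 0) ?size_iota // (nth_map 0) ?size_iota //.
by rewrite !nth_iota.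
Qed.

Lemma head_ok_cfg s : uniq s -> {in s, forall u, u \notin K} ->
  head_ok (iota 0 (size (cfg s))) (look (matrix_of (cfg s))) (catt (cfg s)).
Proof.
case: s => // u0 s'; set s := u0 :: s' => us sK; rewrite size_cfg.
pose P := nth u0 s.
have AE i j : i < size s -> j < size s -> look (matrix_of (cfg s)) i j = F (P i) (P j).
  by move=> si sj; apply: look_cfg.
have tE i : i < size s -> catt (cfg s) i = att (P i) by move=> si; apply: catt_cfg.
have PK i : i < size s -> P i \notin K by move=> si; apply: sK; exact: mem_nth.
have PE i j : i < size s -> j < size s -> (P i == P j) = (i == j).
  by move=> si sj; rewrite nth_uniq.
have s0 : 0 < size s by [].
move: (look _) (catt _) AE tE => A t AE tE.
rewrite /head_ok; cbv beta zeta.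
set N := filter (fun i => A 0 i) _; set Fr := filter _ _.
have inN i : i \in N -> i < size s /\ F (P 0) (P i).
  by rewrite mem_filter mem_iota /= add0n => /andP[+ si]; rewrite AE.
have inF i : i \in Fr -> [/\ i < size s, i != 0 & ~~ F (P 0) (P i)].
  by rewrite mem_filter mem_iota /= add0n => /andP[/andP[+ +] si]; rewrite AE.
move: N Fr inN inF => N Fr inN inF.
have -> : allc (fun b => (t b == 0) || (t b != t 0)) Fr.
  rewrite allcE; apply/allP => b /inF[sb b0 nb]; rewrite !tE //.
  have [//|a0] := eqVneq (att (P b)) 0; apply/negP => /eqP e; move: nb.
  by rewrite FC att_clique ?PK ?PE.
have -> : allc (fun x => allc (fun b => if A x b then
    if (t x == 0) || (t x == t 0) || (t b == t x) then
      allc (fun c => if A x c then (c == b) || A b c else true) Fr else false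
    else true) Fr) N.
  rewrite allcE; apply/allP => x /inN[sx x0]; rewrite allcE.
  apply/allP => b /inF[sb b0 nb]; rewrite AE //; case: ifP => // xb.
  have -> : (t x == 0) || (t x == t 0) || (t b == t x).
    rewrite !tE //; have [//|a0 /=] := eqVneq (att (P x)) 0.
    by rewrite [_ == att (P 0)]eq_sym; apply: att_claw; rewrite ?PK ?PE // 1?eq_sym // FC.
  rewrite allcE; apply/allP => c /inF[sc c0 nc]; rewrite !AE //; case: ifP => // xc.
  have [//|cb /=] := eqVneq c b.
  have := Fcf (x := P x) (a := P 0) (b := P b) (c := P c).
  rewrite !PE // FC x0 xb xc (negPf nb) (negPf nc) /= ![0 == _]eq_sym b0 c0 [b == c]eq_sym cb.
  by apply.
have -> // : allc (fun b => allc (fun c => if b == c then true else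
    if A b c then
      if allc (fun z => if A z b then ~~ A z c else true) Fr then
      if allc (fun z => if A b z then (z == c) || A c z else true) N then
      ((t 0 == 0) || (t b != t 0) || (t c == t 0)) &&
      ((t b == 0) || (t b != t c) || (t b == t 0))
      else false else false
    else
      if (t 0 == 0) || (t b == t 0) || (t c == t 0) then
        allc (fun z => [|| z == b, z == c, A b z | A c z]) N
      else false) N) N.
rewrite allcE; apply/allP => b /inN[sb b0]; rewrite allcE; apply/allP => c /inN[sc c0].
have [//|bc] := eqVneq b c; rewrite AE //; case: ifP => [fbc|/negbT nbc].
  have -> : allc (fun z => if A z b then ~~ A z c else true) Fr.
    rewrite allcE; apply/allP => z /inF[sz z0 nz]; rewrite !AE //; case: ifP => // zb.
    apply/negP => zc; move/negP: nz; apply; apply: (Fdf (x := P b) (y := P c)) => //.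
    - by rewrite FC.
    - by rewrite FC.
    - by rewrite FC.
    - by rewrite FC.
    by rewrite PE // eq_sym.
  have -> : allc (fun z => if A b z then (z == c) || A c z else true) N.
    rewrite allcE; apply/allP => z /inN[sz z0]; rewrite !AE //; case: ifP => // bz.
    have [//|zc /=] := eqVneq z c; apply: (Fdf (x := P 0) (y := P b)) => //.
    by rewrite PE // eq_sym.
  rewrite !tE //; apply/andP; split.
    have [//|a0 /=] := eqVneq (att (P 0)) 0; have [e|//] := eqVneq (att (P b)) (att (P 0)).
    by rewrite /= (att_triangle (u := P 0) (b := P b) (c := P c)) ?PK.
  have [//|a0 /=] := eqVneq (att (P b)) 0; have [e|//] := eqVneq (att (P b)) (att (P c)).
  rewrite /= (att_triangle (u := P b) (b := P c) (c := P 0)) ?PK //.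
  - by rewrite FC.
  by rewrite FC.
have -> : (t 0 == 0) || (t b == t 0) || (t c == t 0).
  rewrite !tE //; have [//|a0 /=] := eqVneq (att (P 0)) 0.
  by apply: att_claw; rewrite ?PK ?PE.
rewrite allcE; apply/allP => z /inN[sz z0]; rewrite !AE //.
have [//|zb] := eqVneq z b; have [//|zc /=] := eqVneq z c.
have := Fcf (x := P 0) (a := P b) (b := P c) (c := P z).
by rewrite !PE // b0 c0 z0 bc [b == z]eq_sym zb [c == z]eq_sym zc (negPf nbc); apply.
Qed.

Definition attach_steps (s : seq T) := forall s1 u s2, s = s1 ++ u :: s2 ->
  att u \in [:: last_att (cfg s2); (last_att (cfg s2)).+1].

(** Lists grow at the front, so the search passes through the suffixes of [s' ++ s], and
    [head_ok_cfg] ensures that it prunes none of them. *)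
Lemma search_sound fuel s s' : search fuel (cfg s) -> size s' <= fuel ->
  uniq (s' ++ s) -> {in s' ++ s, forall u, u \notin K} -> attach_steps (s' ++ s) ->
  leaf_ok (cfg (s' ++ s)) (matrix_of (cfg (s' ++ s))).
Proof.
elim: fuel s s' => [|f IH] s s' /=; rewrite -/(cfg s).
  case: s' => // + _ us sK _; rewrite head_ok_cfg //.
  by case: leaf_ok.
case/lastP: s' => [|s' u] + sz us sK st.
  by rewrite head_ok_cfg //; case: leaf_ok.
have us' : uniq s by move: us; rewrite cat_uniq => /and3P[].
have sK' : {in s, forall u, u \notin K}.
  by move=> v vs; apply: sK; rewrite mem_cat vs orbT.
rewrite head_ok_cfg //; case: leaf_ok => //.
rewrite cat_rcons in us sK st *.
have := st _ _ _ (erefl _).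
set la := last_att _ => ula srch.
have : search f (cfg (u :: s)).
  have := mem_rows (map (F u) s); rewrite size_map -size_cfg => mr.
  move: srch; case: ifP => // h1; case: ifP => // h2 _.
  rewrite allcE in h1; rewrite allcE in h2.
  move/allP: h1 => h1; move/allP: h2 => h2.
  by move: ula; rewrite !inE => /orP[/eqP e|/eqP e]; rewrite [cfg _]/= e; [exact: h1|exact: h2].
by move=> /IH; apply => //; rewrite size_rcons in sz.
Qed.

(** Nonincreasing, because [search] adds vertices of nondecreasing class at the front. *)
Definition outer : seq T := sort (fun u v => att v <= att u) (enum (~: K)).

Lemma mem_outer u : (u \in outer) = (u \notin K).
Proof. by rewrite mem_sort mem_enum inE. Qed.

Lemma outer_uniq : uniq outer.
Proof. by rewrite sort_uniq enum_uniq. Qed.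

Lemma perm_outer : perm_eq outer (enum (~: K)).
Proof. by rewrite perm_sort. Qed.

Lemma size_outer : size outer = #|~: K|.
Proof. by rewrite size_sort -cardE. Qed.

Lemma att_surj u a : 0 < a < att u -> exists2 v, v \notin K & att v = a.
Proof.
case/andP=> a0 au; have au' : a.-1 < size feet.
  move: au; rewrite /att; case: ifP => //; rewrite has_find => h; lia.
have kf : nth u feet a.-1 \in feet by exact: mem_nth.
have := kf; rewrite mem_feet => /andP[kK /existsP[v /andP[vK vk]]].
have [v0 vf] := att0P vK kK vk; exists v => //.
have : foot v == nth u feet a.-1 by rewrite vf.
rewrite /foot (set_nth_default u) ?nth_uniq ?feet_uniq //; last first.
- by move: v0; rewrite /att; case: ifP => //=; rewrite has_find.
- by move: v0; rewrite /att; case: ifP => //=; rewrite has_find.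
by move=> /eqP; lia.
Qed.

Lemma outer_steps : attach_steps outer.
Proof.
move=> s1 u s2 so.
have trans : transitive (fun u v : T => att v <= att u).
  by move=> x y z /[swap] xz /(leq_trans xz).
have : sorted (fun u v => att v <= att u) outer.
  by apply: sort_sorted => x y; exact: leq_total.
rewrite sorted_pairwise // so pairwise_cat pairwise_cons => /and3P[/allrelP h1 _ /andP[/allP h2 h3]].
have la_le : last_att (cfg s2) <= att u.
  by case: s2 h2 {so h1 h3} => // v s2 /(_ v); rewrite mem_head; exact.
have le_la w : w \in s2 -> att w <= last_att (cfg s2).
  case: s2 h3 {so h1 h2 la_le} => // v s2 /andP[/allP h _].
  by rewrite inE => /predU1P[->//|/h].
suff : att u <= (last_att (cfg s2)).+1 by rewrite !inE; move: la_le; lia.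
(* A jump by two would leave no place in the list for the class just below that of [u], which is
   inhabited by [att_surj]. *)
rewrite leqNgt; apply/negP => lt.
have [|w wK aw] := @att_surj u (att u).-1; first lia.
have : w \in outer by rewrite mem_outer.
rewrite so mem_cat inE => /or3P[ws1|/eqP wu|/le_la]; last by lia.
  by have := h1 w u ws1 (mem_head _ _); lia.
by rewrite wu in aw; lia.
Qed.

Lemma outer_leaf : #|~: K| <= 6 -> leaf_ok (cfg outer) (matrix_of (cfg outer)).
Proof.
move=> c6; rewrite -[outer]cats0; apply: (@search_sound 6).
- exact: search_complete.
- by rewrite size_outer.
- by rewrite cats0 outer_uniq.
- by move=> u; rewrite cats0 mem_outer.
by rewrite cats0; exact: outer_steps.
Qed.

(** The ends of disjoint blocks are distinct clique vertices, so clique edges link each block to the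
    next and the last to the first. A lone clique vertex also counts as a block. *)
Lemma ham_blocks (bs : seq (seq T)) : 2 < #|T| ->
  (forall b, b \in bs -> exists x y, [/\ x \in K, y \in K & hpath F x y b]) ->
  spanning (flatten bs) -> ham_rel F.
Proof.
move=> T3 hb [uf ff].
have : bs != [::] by case: bs ff {hb uf} => // /(_ g).
have gen : bs != [::] -> uniq (flatten bs) ->
    exists x y, [/\ x \in K, y \in K & hpath F x y (flatten bs)].
  elim: bs {uf ff} hb => // b bs IH hb _.
  have [x [y [xK yK h]]] := hb b (mem_head _ _).
  have [->|bs0] := eqVneq bs [::]; first by rewrite /= cats0; exists x, y.
  move=> /[dup] ub; rewrite /= cat_uniq => /and3P[_ _ ub'].
  have [b' b'bs|x' [y' [x'K y'K h']]] := IH _ bs0 ub'.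
    by apply: hb; rewrite inE b'bs orbT.
  exists x, y'; split=> //; apply: (hpath_cat h _ h'); apply: Kcl => //.
  apply/negP => /eqP yx'; apply: (uniq_catN ub (mem_hpath_last h)).
  by rewrite yx'; exact: mem_hpath_head h'.
move=> bs0; have [x [y [xK yK h]]] := gen bs0 uf.
apply: (ham_hpath T3 _ h); first by split.
apply: Kcl => //; apply/negP => /eqP yx; move: h uf ff; rewrite yx.
case: (flatten bs) => // z [|w s] /and3P[/eqP-> /= lx _] /=.
  move=> _ all; have /card_uniqP : uniq [:: x] by [].
  have -> : #|[:: x]| = #|T| by apply: eq_card => v; rewrite all.
  by move=> /= cT; rewrite cT in T3.
by rewrite -(eqP lx) => /andP[]; rewrite -[w :: s]/(w :: s) mem_last.
Qed.

Section Leaf.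
Hypothesis T3 : 2 < #|T|.
Let m := size outer.
Let P i := nth g outer i.

Lemma outer_nth i : i < m -> P i \notin K.
Proof. by move=> im; rewrite -mem_outer mem_nth. Qed.

(** Each path of the cover is prolonged by the feet of its two ends, and every clique vertex left
    over becomes a block of its own. *)
Lemma ham_path_cover :
  path_cover (look (matrix_of (cfg outer))) (catt (cfg outer)) (2 * m).+1 (iota 0 m) None [::] ->
  ham_rel F.
Proof.
case/cover_sound => //; first exact: iota_uniq.
set A := look _; set t := catt _; move=> ps [pps gps]; rewrite cats0 => ups.
have lt p i : p \in ps -> i \in p -> i < m.
  move=> pp ip; have : i \in flatten ps by apply/flattenP; exists p.
  by rewrite (perm_mem pps) mem_iota.
have ne p : p \in ps -> p != [::] by move=> /(allP gps); case: p.
pose kh p := foot (P (head 0 p)); pose kl p := foot (P (last 0 p)).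
have hin p : p \in ps -> head 0 p < m /\ last 0 p < m.
  move=> pp; have := ne p pp; have := lt p _ pp; case: p {pp} => // x q l _ /=.
  by split; apply: l; rewrite ?mem_head ?mem_last.
have tE i : i < m -> t i = att (P i) by move=> im; exact: catt_cfg.
have ends0 p : p \in ps -> att (P (head 0 p)) != 0 /\ att (P (last 0 p)) != 0.
  move=> pp; have [h1 h2] := hin p pp; have := allP gps p pp.
  by case: p pp h1 h2 => // x q _ /= h1 h2 /and3P[_]; rewrite !tE.
have kK p : p \in ps -> kh p \in K /\ kl p \in K.
  by move=> /ends0[/footP[h1 _] /footP[h2 _]].
pose E := flatten [seq [:: kh p; kl p] | p <- ps].
have EK k : k \in E -> k \in K.
  by move=> /flatten_mapP[p /kK[h1 h2]]; rewrite !inE => /orP[] /eqP->.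
have uE : uniq E.
  (* [h] recovers the class from a foot, so the feet are distinct because the classes of the ends
     are. *)
  pose h (k : T) := att (nth g outer (find (fun u => (att u != 0) && (foot u == k)) outer)).
  apply: (@map_uniq _ _ h); suff -> : map h E = flatten (map (path_ends t) ps) by [].
  rewrite /E map_flatten -map_comp; congr flatten; apply/eq_in_map => p pp /=.
  have hfoot i : i < m -> att (P i) != 0 -> h (foot (P i)) = t i.
    move=> im a0; rewrite tE // /h; apply/eqP.
    have hs : has (fun u => (att u != 0) && (foot u == foot (P i))) outer.
      by apply/hasP; exists (P i); rewrite ?mem_nth // a0 eqxx.
    have := nth_find g hs; rewrite /= => /andP[b0]; by rewrite foot_inj.
  have [h1 h2] := hin p pp; have [e1 e2] := ends0 p pp.
  by rewrite /path_ends !hfoot.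
pose rest := [seq k <- enum K | k \notin E].
pose bs := [seq kh p :: rcons (map P p) (kl p) | p <- ps] ++ [seq [:: k] | k <- rest].
have pbs : perm_eq (flatten bs) (map P (flatten ps) ++ E ++ rest).
  rewrite /bs flatten_cat; have -> : flatten [seq [:: k] | k <- rest] = rest.
    by elim: (rest) => //= k r ->.
  rewrite catA perm_cat2r /E; elim: (ps) => //= p qs IH.
  rewrite map_cat -cats1; move: IH; set f1 := flatten _; set f2 := map P _; set f3 := flatten _.
  move=> /permP IH; apply/permP => z; have := IH z.
  by rewrite /= !count_cat /=; lia.
apply: (@ham_blocks bs) => //.
- move=> b; rewrite mem_cat => /orP[/mapP[p pp ->]|/mapP[k]]; last first.
    rewrite mem_filter mem_enum => /andP[_ kK'] ->.
    by exists k, k; split=> //; exact: hpath1.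
  exists (kh p), (kl p); have [h1 h2] := kK p pp; split=> //.
  have [e1 e2] := ends0 p pp; have [_ f1] := footP e1; have [_ f2] := footP e2.
  have := allP gps p pp; have := lt p _ pp; rewrite /kh /kl in f1 f2 *.
  case: p {pp h1 h2 e1 e2} f1 f2 => // x q /= f1 f2 ltq /and3P[pq _ _].
  rewrite /hpath !eqxx /= last_rcons eqxx /= FC f1 /= rcons_path last_map f2 andbT.
  rewrite path_map; apply: (sub_in_path (P := [pred i | i < m]) (e := A)) => //.
    by move=> i j; rewrite !inE => im jm; rewrite /A (look_cfg g) //.
  by apply/allP => i /ltq.
have uPf : uniq (map P (flatten ps)).
  rewrite map_inj_in_uniq ?(perm_uniq pps) ?iota_uniq // => i j.
  rewrite !(perm_mem pps) !mem_iota /= add0n => im jm /eqP.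
  by rewrite nth_uniq ?outer_uniq // => /eqP.
have PfK x : x \in map P (flatten ps) -> x \notin K.
  by move=> /mapP[i]; rewrite (perm_mem pps) mem_iota => /= im ->; exact: outer_nth.
split.
  rewrite (perm_uniq pbs) !cat_uniq uPf uE filter_uniq ?enum_uniq //= andbT has_cat negb_or.
  apply/andP; split; last by apply/hasPn => k; rewrite mem_filter => /andP[].
    apply/andP; split; apply/hasPn => k.
      by move=> /EK kK'; apply/negP => /PfK; rewrite kK'.
    by rewrite mem_filter mem_enum => /andP[_ kK']; apply/negP => /PfK; rewrite kK'.
move=> x; rewrite (perm_mem pbs) !mem_cat mem_filter mem_enum.
have [xK|xK] := boolP (x \in K); first by rewrite andbT; case: (x \in E); rewrite ?orbT.
rewrite (_ : x \in map P _) //; apply/mapP.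
have xo : x \in outer by rewrite mem_outer.
exists (index x outer); last by rewrite /P nth_index.
by rewrite (perm_mem pps) mem_iota /= add0n index_mem.
Qed.

Definition two_connected (r : rel T) := forall X : {set T}, #|X| < 2 ->
  forall x y, x \notin X -> y \notin X ->
    connect (fun a b => [&& a \notin X, b \notin X & r a b]) x y.

(** [X] is the boundary of [S], at most one vertex. No edge leaves [S] once [X] is removed, so [S]
    would be cut off from [g]. *)
Lemma not_separated : two_connected F ->
  ~~ separated (iota 0 m) (look (matrix_of (cfg outer))) (catt (cfg outer)).
Proof.
move=> F2; rewrite /separated hascE; apply/hasPn => S /mem_sublists SV.
case: ifP => // /negbT S0; apply/negP; rewrite /weakly_attached.
have lt i : i \in S -> i < m by move=> /SV; rewrite mem_iota.
set L := filter _ (iota 0 m); set C := undup _ => LC.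
have tE i : i < m -> catt (cfg outer) i = att (P i) by move=> im; exact: catt_cfg.
pose footn k := foot (nth g outer (find (fun u => att u == k) outer)).
have footnE u : u \notin K -> att u != 0 -> footn (att u) = foot u.
  move=> uK a0; have hs : has (fun v => att v == att u) outer.
    by apply/hasP; exists u; rewrite ?mem_outer.
  by have /eqP e := nth_find g hs; apply: foot_eq; rewrite e.
pose X := [set x in map P L ++ map footn C].
have X2 : #|X| < 2.
  rewrite ltnS cardsE; apply: leq_trans (card_size _) _.
  by rewrite size_cat !size_map.
have [s0 s0S] : exists i, i \in S by case: (S) S0 => // i S' _; exists i; rewrite mem_head.
pose Y := [set x in map P S].
have YK y : y \in Y -> y \notin K.
  by rewrite inE => /mapP[i /lt im ->]; exact: outer_nth.
have LS i : i \in L -> i \notin S by rewrite mem_filter; case: ifP.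
have footX u : u \in Y -> att u != 0 -> foot u \in X.
  move=> uY a0; rewrite -footnE ?YK // inE mem_cat orbC map_f //.
  move: uY a0; rewrite inE => /mapP[i iS ->] a0.
  by rewrite mem_undup mem_filter a0 -tE ?lt // map_f.
have Xfoot k : k \in X -> k \in K -> exists2 u, u \notin K & F u k.
  rewrite inE mem_cat => /orP[/mapP[i]|/mapP[a]].
    rewrite mem_filter mem_iota /= => /andP[_ im] ->.
    by rewrite (negPf (outer_nth im)).
  rewrite mem_undup mem_filter => /andP[a0 /mapP[i iS ai]] -> _.
  have im := lt i iS; exists (P i); first exact: outer_nth.
  rewrite ai tE // in a0 *; rewrite footnE ?outer_nth //.
  by have [] := footP a0.
have Ps0 : P s0 \in Y by rewrite inE map_f.
have YX y : y \in Y -> y \notin X.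
  move=> yY; apply/negP; rewrite inE mem_cat => /orP[/mapP[i iL yi]|/mapP[a]].
    move: (yY); rewrite inE => /mapP[j jS yj]; have := LS i iL.
    move: iL; rewrite mem_filter mem_iota /= => /andP[_ im].
    suff -> : i = j by rewrite jS.
    apply/eqP; rewrite -(nth_uniq g im (lt j jS) outer_uniq); apply/eqP.
    by rewrite -/(P i) -/(P j) -yi.
  rewrite mem_undup mem_filter => /andP[a0 /mapP[i iS ai]] ya.
  have im := lt i iS; rewrite ai tE // footnE ?outer_nth -?tE -?ai // in ya.
  have [fK _] : foot (P i) \in K /\ F (P i) (foot (P i)).
    by apply: footP; rewrite -tE // -ai.
  by move: (YK y yY); rewrite ya fK.
have gX : g \notin X.
  apply/negP => /Xfoot/(_ gK)[u uK]; exact/negP/gfar.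
have := F2 X X2 (P s0) g (YX _ Ps0) gX.
have cl : closed (fun a b => [&& a \notin X, b \notin X & F a b]) (mem Y).
  have half a b : [&& a \notin X, b \notin X & F a b] -> a \in Y -> b \in Y.
    move=> /and3P[aX bX ab] aY; have [bK|bK] := boolP (b \in K).
      have [a0 fa] := att0P (YK _ aY) bK ab.
      by move: bX; rewrite -fa footX.
    have : b \in outer by rewrite mem_outer.
    move=> bo; have ib : index b outer < m by rewrite index_mem.
    have Pb : P (index b outer) = b by rewrite /P nth_index.
    have [iS|nS] := boolP (index b outer \in S); first by rewrite inE -Pb map_f.
    move/negP: bX; case; rewrite inE mem_cat; apply/orP; left; apply/mapP.
    exists (index b outer); last by rewrite Pb.
    rewrite mem_filter (negPf nS) mem_iota /= add0n ib andbT.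
    move: aY; rewrite inE => /mapP[j jS aj]; rewrite hascE; apply/hasP; exists j => //.
    have abP : F (P (index b outer)) (P j) by rewrite Pb -aj FC.
    by rewrite (look_cfg g ib (lt j jS)).
  move=> a b ab; apply/idP/idP; first exact: half.
  by apply: half; rewrite FC; case/and3P: ab => -> -> ->.
move=> /(closed_connect cl); rewrite /= Ps0 => /esym /YK.
by rewrite gK.
Qed.

Lemma edge_countE :
  edge_count (iota 0 m) (look (matrix_of (cfg outer))) =
    \sum_(u | u \notin K) #|[pred v | (v \notin K) && F u v]|.
Proof.
rewrite /edge_count sumnE big_map.
have -> : \sum_(u | u \notin K) #|[pred v | (v \notin K) && F u v]| =
    \sum_(u <- outer) count (F u) outer.
  rewrite (perm_big _ perm_outer) /=.
  rewrite big_enum /=; apply: eq_big => [u|u _]; first by rewrite inE.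
  rewrite (permP perm_outer) -size_filter cardE.
  rewrite /enum_mem -filter_predI; congr size; apply: eq_filter => v.
  by rewrite !inE andbC.
rewrite (big_nth g) -/m; rewrite /index_iota subn0; apply: eq_big_seq => i.
rewrite mem_iota /= add0n => im.
have -> : count (F (nth g outer i)) outer = count (F (nth g outer i)) (map P (iota 0 m)).
  by congr count; rewrite -[LHS](mkseq_nth g).
rewrite count_map; apply: eq_in_count => j.
by rewrite mem_iota /= add0n => jm; rewrite (look_cfg g).
Qed.

(** EP' without its numbering: [k1], [k2] play [a1], [b1], and [s] lists [a2], [a3], [b2], [b3],
    [c2], [c3]. *)
Definition ep_structure := exists k1 k2 (s : seq T),
  [/\ [/\ k1 \in K, k2 \in K & k1 != k2], uniq s, size s = 6,
      forall x, (x \in s) = (x \notin K) &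
      (forall i j, i < 6 -> j < 6 -> F (nth g s i) (nth g s j) =
         ((i, j) \in ep_edges) || ((j, i) \in ep_edges)) /\
      (forall i k, i < 6 -> k \in K -> F (nth g s i) k =
         (i < 2) && (k == k1) || (1 < i < 4) && (k == k2))].

Lemma ep_likeP p : m = 6 -> p \in ep_orders ->
  ep_like (look (matrix_of (cfg outer))) (catt (cfg outer)) p -> ep_structure.
Proof.
move=> m6 po; rewrite /ep_like.
have pp : perm_eq p (iota 0 6).
  by move: po; rewrite !inE => /or4P[] /eqP->.
have sp : size p = 6 by rewrite (perm_size pp).
have pl i : i < 6 -> nth 0 p i < m.
  move=> i6; have : nth 0 p i \in p by rewrite mem_nth ?sp.
  by rewrite (perm_mem pp) mem_iota m6.
have tE i : i < 6 -> catt (cfg outer) (nth 0 p i) = att (P (nth 0 p i)).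
  by move=> i6; apply: catt_cfg; exact: pl.
rewrite !tE //; set Q := fun i => P (nth 0 p i).
rewrite -/(Q 0) -/(Q 1) -/(Q 2) -/(Q 3) -/(Q 4) -/(Q 5).
move=> /and5P[t0 /eqP t1 t2 /eqP t3 /and4P[t20 /eqP t4 /eqP t5 adjA]].
have QK i : i < 6 -> Q i \notin K by move=> i6; apply: outer_nth; exact: pl.
have [k0K f0] := footP t0; have [k2K f2] := footP t2.
exists (foot (Q 0)), (foot (Q 2)), (map P p); split.
- by rewrite foot_inj // eq_sym t20.
- rewrite map_inj_in_uniq ?(perm_uniq pp) // => i j.
  rewrite !(perm_mem pp) !mem_iota /= add0n -m6 => im jm /eqP.
  by rewrite nth_uniq ?outer_uniq // => /eqP.
- by rewrite size_map.
- move=> x; apply/mapP/idP => [[i]|xK].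
    by rewrite (perm_mem pp) mem_iota /= add0n -m6 => im ->; exact: outer_nth.
  have xo : x \in outer by rewrite mem_outer.
  exists (index x outer); last by rewrite /P nth_index.
  by rewrite (perm_mem pp) mem_iota /= add0n -m6 index_mem.
have nE i : i < 6 -> nth g (map P p) i = Q i by move=> i6; rewrite (nth_map 0) ?sp.
split=> [i j i6 j6|i k i6 kK].
  rewrite !nE // -(look_cfg g (pl i i6) (pl j j6)).
  have /allP/(_ i) := adjA; rewrite mem_iota i6 => /(_ isT)/allP/(_ j).
  by rewrite mem_iota j6 => /(_ isT)/eqP.
rewrite nE //; have noatt j : att (Q j) = 0 -> j < 6 -> F (Q j) k = false.
  by move=> a0 j6; apply/negP => /(att0P (QK _ j6) kK)[]; rewrite a0.
have hatt j l : j < 6 -> l < 6 -> att (Q l) != 0 -> att (Q j) = att (Q l) ->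
    F (Q j) k = (k == foot (Q l)).
  move=> j6 l6 a0 e; apply/idP/eqP => [h|->].
    by have [a1 <-] := att0P (QK _ j6) kK h; exact: foot_eq.
  by rewrite -(foot_eq _ e) ?e //; have [] := @footP (Q j); rewrite ?e.
case: i i6 => [|[|[|[|[|[|]]]]]] // _ /=; rewrite ?orbF.
- exact: hatt.
- exact: hatt.
- exact: hatt.
- exact: hatt.
- exact: noatt.
exact: noatt.
Qed.

Lemma small_remainder : two_connected F -> #|~: K| <= 6 ->
  [\/ ham_rel F,
      #|~: K| = 6 /\ \sum_(u | u \notin K) #|[pred v | (v \notin K) && F u v]| <= 14 |
      ep_structure].
Proof.
move=> F2 /outer_leaf; rewrite /leaf_ok size_cfg -/m -edge_countE.
case: ifP => [+ _|_]; first by case: eqP => // m6 h; constructor 2; rewrite -size_outer.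
case: ifP => [/ham_path_cover h _|_]; first by constructor 1.
rewrite (negPf (not_separated F2)).
case: eqP => // m6; rewrite hascE => /hasP[p po h].
by constructor 3; exact: ep_likeP h.
Qed.

End Leaf.

End Transfer.

(** * A clique missing at most six vertices *)

Section LargeClique.
Variables (T : finType) (F : rel T).
Hypotheses (FC : symmetric F) (FI : irreflexive F).
Hypotheses (Fcf : clawless F) (Fdf : diamondless F).

Let n := #|T|.
Definition nonadj : rel T := fun u v => (u != v) && ~~ F u v.
Definition nbrs u := [set v | F u v].
Definition conbrs u := [set v | nonadj u v].

Lemma nonadjC : symmetric nonadj.
Proof. by move=> u v; rewrite /nonadj eq_sym FC. Qed.

Lemma card_nbrs_conbrs u : #|nbrs u| + #|conbrs u| = n.-1.
Proof.
have -> : conbrs u = [set~ u] :\: nbrs u.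
  by apply/setP => v; rewrite !inE /nonadj eq_sym andbC.
rewrite -(cardsC1 u) -(cardsID (nbrs u) [set~ u]); congr (_ + _); apply: eq_card => v.
rewrite !inE andbC; case: eqP => [->|]; by rewrite ?FI ?andbT.
Qed.

(** Two adjacent common neighbours would give a diamond with [u] and [v], three pairwise nonadjacent
    ones a claw at [u]. *)
Lemma card_common u v : nonadj u v -> #|nbrs u :&: nbrs v| <= 2.
Proof.
move=> /andP[uv nuv]; rewrite leqNgt; apply/negP => /card_gt2P[a [b [c [[]]]]].
rewrite !inE => /andP[ua va] /andP[ub vb] /andP[uc vc] [ab bc ca].
have ind x y : F u x -> F v x -> F u y -> F v y -> ~~ F x y.
  move=> ux vx uy vy; apply/negP => xy; move/negP: nuv; apply.
  by apply: (Fdf xy) => //; rewrite FC.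
have := Fcf ua ub uc ab; rewrite eq_sym in ca; rewrite ca bc => /(_ isT isT).
by rewrite (negPf (ind a b _ _ _ _)) // (negPf (ind a c _ _ _ _)) // (negPf (ind b c _ _ _ _)).
Qed.

(** Both neighbourhoods lie among the other [n - 2] vertices and overlap in at most two, so the
    degrees in [F] add up to at most [n]. *)
Lemma nonadj_degrees u v : nonadj u v -> n - 2 <= #|conbrs u| + #|conbrs v|.
Proof.
move=> uv; have c2 := card_common uv; have /andP[neq nuv] := uv.
have := cardsUI (nbrs u) (nbrs v); have := card_nbrs_conbrs u; have := card_nbrs_conbrs v.
have : #|nbrs u :|: nbrs v| + 2 <= n.
  rewrite -[n](cardsC [set u; v]) cards2 neq addnC leq_add2l; apply: subset_leq_card.
  apply/subsetP => w; rewrite !inE negb_or => /orP[] h.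
    by apply/andP; split; apply: contraTneq h => ->; rewrite ?FI.
  by apply/andP; split; apply: contraTneq h => ->; rewrite ?FI // FC.
lia.
Qed.

(** Sum [nonadj_degrees] over all ordered nonadjacent pairs: each vertex enters with its codegree,
    as often as its codegree, in either place. *)
Lemma sum_conbrs_sq :
  (n - 2) * (\sum_u #|conbrs u|) <= 2 * \sum_u #|conbrs u| ^ 2.
Proof.
have card_nonadj u : #|[pred v | nonadj u v]| = #|conbrs u|.
  by apply: eq_card => v; rewrite !inE.
have e1 : \sum_u \sum_(v | nonadj u v) #|conbrs u| = \sum_u #|conbrs u| ^ 2.
  by apply: eq_bigr => u _; rewrite sum_nat_const card_nonadj.
have e2 : \sum_u \sum_(v | nonadj u v) #|conbrs v| = \sum_u #|conbrs u| ^ 2.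
  rewrite -e1 (exchange_big_dep xpredT) //=; apply: eq_bigr => u _.
  by apply: eq_bigl => v; rewrite nonadjC.
rewrite mul2n -addnn -{1}e1 -e2 -big_split /= big_distrr /=; apply: leq_sum => u _.
rewrite -big_split /=; apply: leq_trans (_ : #|[pred v | nonadj u v]| * (n - 2) <= _).
  by rewrite card_nonadj mulnC.
by rewrite -sum_nat_const; apply: leq_sum => v uv; exact: nonadj_degrees.
Qed.

Definition cliqueb (K : {set T}) := [forall x in K, forall y in K, (x != y) ==> F x y].

Lemma cliqueP (K : {set T}) : reflect {in K &, forall x y, x != y -> F x y} (cliqueb K).
Proof.
apply: (iffP forall_inP) => [h x y xK yK xy|h x xK].
  by have /forall_inP/(_ y yK)/implyP/(_ xy) := h x xK.
by apply/forall_inP => y yK; apply/implyP; exact: h.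
Qed.

Lemma sum_conbrs_cross (A B : {set T}) : [disjoint A & B] ->
  {in A & B, forall x y, ~~ F x y} -> 2 * (#|A| * #|B|) <= \sum_u #|conbrs u|.
Proof.
move=> dAB nF; have half (A' B' : {set T}) : [disjoint A' & B'] ->
    {in A' & B', forall x y, ~~ F x y} -> #|A'| * #|B'| <= \sum_(u in A') #|conbrs u|.
  move=> d h; rewrite -sum_nat_const; apply: leq_sum => u uA.
  apply: subset_leq_card; apply/subsetP => v vB; rewrite inE /nonadj h // andbT.
  by apply: contraTneq vB => <-; rewrite (disjointFr d).
rewrite (bigID (mem A)) /= mul2n -addnn leq_add ?half //.
rewrite mulnC; apply: leq_trans (half B A _ _) _; first by rewrite disjoint_sym.
  by move=> x y xB yA; rewrite FC nF.
rewrite [leqRHS](bigID (mem B)) /=; apply: leq_trans (leq_addr _ _).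
rewrite leq_eqVlt; apply/orP; left; apply/eqP; apply: eq_bigl => u.
by case uB: (u \in B); rewrite ?andbF // andbT (disjointFl dAB).
Qed.

(** Adjacency is transitive on the neighbourhood of [v], since a path with nonadjacent ends would
    give a diamond; claw-freeness allows at most two classes. *)
Lemma nbrs_two_cliques v a b : F v a -> F v b -> nonadj a b ->
  exists A B : {set T}, [/\ nbrs v = A :|: B, [disjoint A & B],
    {in A & B, forall x y, ~~ F x y}, cliqueb A & cliqueb B].
Proof.
move=> va vb /andP[ab nab].
pose A := [set w in nbrs v | (w == a) || F a w].
pose B := [set w in nbrs v | (w == b) || F b w].
have AB w : w \in A -> w \in B -> False.
  rewrite !inE => /andP[vw /orP[/eqP->|aw]] /andP[_ /orP[/eqP e|bw]].
  - by rewrite e eqxx in ab.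
  - by rewrite FC (negPf nab) in bw.
  - by rewrite e (negPf nab) in aw.
  by move/negP: nab; apply; apply: (Fdf vw) => //; rewrite FC.
have cross : {in A & B, forall x y, ~~ F x y}.
  move=> p q pA qB; apply/negP => pq; apply: (AB q) => //.
  move: pA qB; rewrite !inE => /andP[vp /orP[/eqP<-|ap]] /andP[vq _].
    by rewrite vq pq orbT.
  rewrite vq eq_sym; case: eqVneq => //= aq.
  by apply: (Fdf vp) => //; rewrite FC.
have aA : a \in A by rewrite !inE va eqxx.
have bB : b \in B by rewrite !inE vb eqxx.
have vA w : w \in A -> F v w by rewrite !inE => /andP[].
have vB w : w \in B -> F v w by rewrite !inE => /andP[].
exists A, B; split=> //.
- apply/setP => w; rewrite !inE -andb_orr; case vw: (F v w) => //=.
  have [//|wa] := eqVneq w a; have [|wb] := eqVneq w b; first by rewrite orbT.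
  have := Fcf va vb vw ab; rewrite (eq_sym a) (eq_sym b) wa wb (negPf nab) /=.
  by move=> /(_ isT isT) ->.
- by rewrite disjoint_subset; apply/subsetP => w wA; apply/negP => /(AB w wA).
- apply/cliqueP => x y xA yA xy.
  have := Fcf (vA x xA) (vA y yA) vb xy; rewrite !(negPf (cross _ b _ bB)) // !orbF.
  by apply; apply/eqP => e; apply: (AB b) => //; rewrite -e.
apply/cliqueP => x y xB yB xy.
have := Fcf (vB x xB) (vB y yB) va xy; rewrite !(FC _ a) !(negPf (cross a _ aA _)) // !orbF.
by apply; apply/eqP => e; apply: (AB a) => //; rewrite -e.
Qed.

Lemma card_nonadj_clique (K : {set T}) u : u \notin K ->
  {in K &, forall k k', F u k -> F u k' -> k = k'} ->
  #|K| - 1 <= #|[set k in K | nonadj u k]|.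
Proof.
move=> uK one; have <- := cardsID (nbrs u) K.
have -> : #|K :\: nbrs u| = #|[set k in K | nonadj u k]|.
  apply: eq_card => k; rewrite !inE /nonadj andbC; case kK: (k \in K) => //=.
  by have -> // : u != k; apply: contraTneq kK => <-.
suff : #|K :&: nbrs u| <= 1 by clear; lia.
rewrite leqNgt; apply/negP => /card_gt1P[x [y []]].
by rewrite !inE => /andP[xK ux] /andP[yK uy] /eqP; apply; exact: one.
Qed.

Lemma large_clique : 219 <= n -> 4 * (\sum_u #|conbrs u| ^ 2) <= 25 * n ^ 2 ->
  exists K : {set T}, [/\ {in K &, forall x y, x != y -> F x y},
    forall u, u \notin K -> {in K &, forall k k', F u k -> F u k' -> k = k'}
    & #|~: K| <= 6].
Proof.
move=> n219 sq; set S := \sum_u #|conbrs u|.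
have Sle : 2 * ((n - 2) * S) <= 25 * n ^ 2.
  by apply: leq_trans sq; rewrite -[4]/(2 * 2) -mulnA leq_mul2l sum_conbrs_sq orbT.
(* [S] is at most about [25/2 * n], too little for thirteen nonneighbours at every vertex. *)
have [v dv] : exists v, #|conbrs v| <= 12.
  have [/existsP//|/existsPn big] := boolP [exists v, #|conbrs v| <= 12]; exfalso.
  have : 13 * n <= S.
    rewrite mulnC -sum_nat_const; apply: leq_sum => u _.
    by rewrite ltnNge; exact: big.
  move: Sle n219; clear; rewrite /n; nia.
have cross (A B : {set T}) : [disjoint A & B] -> {in A & B, forall x y, ~~ F x y} ->
    4 * ((n - 2) * (#|A| * #|B|)) <= 25 * n ^ 2.
  by move=> d h; have := sum_conbrs_cross d h; rewrite -/S; move: Sle; clear; nia.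
(* 20 = 13 + 7: [v] with at most twelve nonneighbours, and at most seven vertices in the smaller of
   two cliques, as eight would give too many nonadjacent pairs across. *)
have [K0 clK0 cK0] : exists2 K0 : {set T}, cliqueb K0 & n - 20 <= #|K0|.
  have cv := card_nbrs_conbrs v.
  have [/forall_inP cl|] := boolP (cliqueb (nbrs v)).
    exists (nbrs v); first exact/forall_inP.
    by move: cv dv; rewrite -/n; clear; lia.
  move=> /forall_inPn[a av /forall_inPn[b bv]]; rewrite negb_imply !inE in av bv * => ab.
  have [A [B [NAB dAB cAB clA clB]]] := nbrs_two_cliques av bv ab.
  have := cross A B dAB cAB.
  have cN : #|nbrs v| = #|A| + #|B|.
    by rewrite NAB cardsU (eqP (_ : A :&: B == set0)) ?cards0 ?subn0 // setI_eq0.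
  have [A7|A8] := leqP #|A| 7.
    move=> _; exists B => //; move: cN cv dv n219 A7; rewrite -/n; clear; lia.
  have [B7|B8] := leqP #|B| 7.
    move=> _; exists A => //; move: cN cv dv n219 B7; rewrite -/n; clear; lia.
  move: cN cv dv n219 A8 B8; rewrite -/n; move: #|A| #|B| #|conbrs v| #|nbrs v| (n).
  clear => a b d m n -> e d12 n219 a8 b8 h; exfalso.
  have : 8 * (n - 21) <= a * b by nia.
  nia.
have [K /maxsetP[clK maxK] K0K] := maxset_exists clK0.
have /cliqueP clK' := clK.
(* Without diamonds, a vertex with two neighbours in [K] sees all of [K], against maximality. *)
have one u : u \notin K -> {in K &, forall k k', F u k -> F u k' -> k = k'}.
  move=> uK k k' kK k'K uk uk'; apply/eqP/negPn/negP => kk'.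
  have full w : w \in K -> F u w.
    move=> wK; have [->//|wk] := eqVneq w k; have [->//|wk'] := eqVneq w k'.
    apply: (Fdf (clK' k k' kK k'K kk')).
    - by rewrite FC.
    - by apply: clK'; rewrite // eq_sym.
    - by rewrite FC.
    - by apply: clK'; rewrite // eq_sym.
    by apply: contraNneq uK => ->.
  move/negP: uK; apply; rewrite -(maxK (u |: K)); first by rewrite setU11.
    apply/cliqueP => x y; rewrite !inE => /predU1P[->|xK] /predU1P[->|yK] xy.
    - by rewrite eqxx in xy.
    - exact: full.
    - by rewrite FC full.
    exact: clK'.
  exact: subsetUr.
exists K; split=> //.
have cK : n - 20 <= #|K| by apply: leq_trans cK0 _; exact: subset_leq_card.
have cKC := cardsC K.
have low : 2 * (#|~: K| * (#|K| - 1)) <= S.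
  have nb u : u \notin K -> #|K| - 1 <= #|[set k in K | nonadj u k]|.
    by move=> uK; apply: card_nonadj_clique => //; exact: one.
  have part1 : #|~: K| * (#|K| - 1) <= \sum_(u | u \notin K) #|conbrs u|.
    rewrite -sum_nat_const; rewrite [leqRHS](eq_bigl (mem (~: K))); last first.
      by move=> u; rewrite !inE.
    apply: leq_sum => u; rewrite inE => /nb h; apply: leq_trans h _.
    by apply: subset_leq_card; apply/subsetP => k; rewrite !inE => /andP[].
  have part2 : #|~: K| * (#|K| - 1) <= \sum_(k in K) #|conbrs k|.
    apply: leq_trans (_ : \sum_(k in K) \sum_(u in ~: K) nonadj u k <= _).
      rewrite exchange_big /= -sum_nat_const; apply: leq_sum => u.
      rewrite inE => /nb h; apply: leq_trans h _.
      rewrite -sum1_card big_mkcond /= [leqRHS]big_mkcond /=; apply: leq_sum => k _.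
      by rewrite !inE; case: (k \in K); case: nonadj.
    apply: leq_sum => k kK; rewrite -sum1_card big_mkcond /= [leqRHS]big_mkcond /=.
    apply: leq_sum => u _; rewrite !inE nonadjC.
    by case: (u \in K); case: nonadj.
  rewrite /S (bigID (mem K)) /= mul2n -addnn; exact: leq_add.
move: Sle low cK cKC n219; rewrite -/n; move: S #|K| #|~: K| (n); clear.
move=> S k s n Sle low kn cn n219; rewrite leqNgt; apply/negP => s7.
have ek : k = n - s by lia.
(* Here [s] lies between 7 and 20, and the concave product [s * (n - s - 1)] is least at 7. *)
have : 7 * (n - 8) <= s * (k - 1) by nia.
nia.
Qed.

End LargeClique.

(** * The spectral radius as a maximum of Rayleigh quotients *)

Section QuadraticForm.
Local Open Scope ring_scope.

Definition qform (R : realType) (I : finType) (a : I -> I -> R) (y : I -> R) :=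
  \sum_i \sum_j a i j * y i * y j.

Variables (R : realType) (I : finType) (a : I -> I -> R).
Hypothesis aC : forall i j, a i j = a j i.

Lemma qformD (x y : I -> R) :
  qform a (fun i => x i + y i) =
  qform a x + 2 * (\sum_i y i * \sum_j a i j * x j) + qform a y.
Proof.
have -> : 2 * (\sum_i y i * \sum_j a i j * x j) =
   (\sum_i \sum_j a i j * y i * x j) + (\sum_i \sum_j a i j * x i * y j).
  rewrite [X in _ = _ + X]exchange_big /= mulr_natl mulr2n; congr (_ + _);
  apply: eq_bigr => i _; rewrite big_distrr; apply: eq_bigr => j _ /=.
    ring.
  rewrite (aC i j); ring.
rewrite /qform -!big_split /=; apply: eq_bigr => i _.
rewrite -!big_split; apply: eq_bigr => j _ /=; ring.
Qed.

Lemma qformZ c (x : I -> R) : qform a (fun i => c * x i) = c ^+ 2 * qform a x.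
Proof.
rewrite /qform big_distrr; apply: eq_bigr => i _ /=.
rewrite big_distrr; apply: eq_bigr => j _ /=; ring.
Qed.

(* A quadratic form bounded by [l |y|^2] has every maximizer as eigenvector:
   perturb [x] in the direction of the residual. *)
Lemma qform_eigen (l : R) (x : I -> R) :
  (forall y, qform a y <= l * \sum_i y i ^+ 2) ->
  qform a x = l * \sum_i x i ^+ 2 ->
  forall i, \sum_j a i j * x j = l * x i.
Proof.
move=> ub eqx.
pose g i := \sum_j a i j * x j - l * x i.
pose s := \sum_i g i ^+ 2.
have s0 : 0 <= s by apply: sumr_ge0 => i _; exact: sqr_ge0.
pose k := l * s - qform a g.
have key t : 2 * t * s <= t ^+ 2 * k.
  have := ub (fun i => x i + t * g i).
  rewrite qformD qformZ eqx.
  have -> : \sum_i (x i + t * g i) ^+ 2 =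
    \sum_i x i ^+ 2 + 2 * t * (\sum_i x i * g i) + t ^+ 2 * s.
    rewrite /s !big_distrr -!big_split /=; apply: eq_bigr => i _; ring.
  have -> : \sum_i t * g i * (\sum_j a i j * x j) =
     t * s + l * t * (\sum_i x i * g i).
    rewrite /s !big_distrr -!big_split /=; apply: eq_bigr => i _.
    by rewrite /g; ring.
  rewrite /k; lra.
have k0 : 0 <= k by have := ub g; rewrite /k -/s; lra.
have s_eq0 : s = 0.
  have := key (1 / (k + 1)).
  have kp : 0 < k + 1 by lra.
  have tp : 0 < 1 / (k + 1) by rewrite divr_gt0.
  set t := 1 / (k + 1) in tp *.
  have tk : t * k = 1 - t by rewrite /t; field; lra.
  have -> : t ^+ 2 * k = t * (1 - t) by rewrite -tk; ring.
  move=> h1.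
  (* For the step length [s / (k + 1)] the linear gain exceeds the quadratic loss unless [s] is
     0. *)
  have := key (s / (k + 1)); rewrite -[s / _]/(s * _) -[_^-1]mul1r -/t.
  have -> : (s * t) ^+ 2 * k = s ^+ 2 * t * (1 - t) by rewrite -mulrA -tk; ring.
  move=> h2.
  have : s ^+ 2 * t * (1 + t) <= 0 by nra.
  have : 0 < t * (1 + t) by nra.
  move=> tp2; rewrite -mulrA pmulr_lle0 // => s2.
  by apply/eqP; rewrite -sqrf_eq0 eq_le s2 sqr_ge0.
move=> i.
have : g i ^+ 2 <= 0.
  rewrite -s_eq0 /s (bigD1 i) //= lerDl; apply: sumr_ge0 => j _; exact: sqr_ge0.
move=> gi; apply/eqP; rewrite -subr_eq0 -/(g i) -sqrf_eq0 eq_le gi; exact: sqr_ge0.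
Qed.

Lemma qform_normr (x : I -> R) : (forall i j, 0 <= a i j) ->
  qform a x <= qform a (fun i => `|x i|).
Proof.
move=> a0; apply: ler_sum => i _; apply: ler_sum => j _.
rewrite -!mulrA; apply: ler_wpM2l => //.
by rewrite -normrM ler_norm.
Qed.

End QuadraticForm.

Section MaxRayleigh.
Import all_classical topology normedtype derive numFieldNormedType.Exports.
Local Open Scope ring_scope.
Local Open Scope classical_set_scope.

(** The form is continuous on the compact unit sphere, and scaling extends the bound to all
    vectors. *)
Lemma rayleigh_max (R : realType) (m : nat) (a : 'I_m -> 'I_m -> R) :
  (0 < m)%N ->
  exists x : 'I_m -> R, \sum_i x i ^+ 2 = 1 /\
    forall y : 'I_m -> R, qform a y <= qform a x * \sum_i y i ^+ 2.
Proof.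
move=> m0.
pose ev (v : 'rV[R]_m) i := v ord0 i.
have evc i : continuous (fun v => ev v i) by exact: coord_continuous.
pose S := [set v : 'rV[R]_m | \sum_i ev v i ^+ 2 = 1].
have mulc (f g : 'rV[R]_m -> R) : continuous f -> continuous g ->
    continuous (fun v => f v * g v).
  by move=> fc gc v; apply: continuousM; [exact: fc | exact: gc].
have sumc (f : 'I_m -> 'rV[R]_m -> R) : (forall i, continuous (f i)) ->
    continuous (fun v => \sum_i f i v).
  by move=> fc; apply: (continuous_big (op := +%R)) => //; exact: add_continuous.
have sqc : continuous (fun v : 'rV[R]_m => \sum_i ev v i ^+ 2).
  apply: sumc => i.
  have -> : (fun v => ev v i ^+ 2) = (fun v => ev v i * ev v i).
    by apply/funext => w; rewrite expr2.
  exact: mulc.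
have qc : continuous (fun v : 'rV[R]_m => qform a (ev v)).
  apply: (sumc) => i; apply: (sumc) => j; apply: (mulc) => //; apply: (mulc) => //.
  exact: cst_continuous.
have cS : compact S.
  apply: bounded_closed_compact; last first.
    rewrite -[S]/((fun v : 'rV[R]_m => \sum_i ev v i ^+ 2) @^-1` [set 1]).
    apply: preimage_closed; last exact: closed_eq.
    by move=> v _; exact: sqc.
  exists 1; split=> // M M1 v /= sv.
  rewrite [leLHS]/Num.norm /= mx_normrE; apply/bigmax_leP; split => [|[i j] _ /=].
    by apply: ltW; exact: lt_trans M1.
  have : ev v j ^+ 2 <= 1.
    by rewrite -sv (bigD1 j) //= lerDl; apply: sumr_ge0 => k _; exact: sqr_ge0.
  rewrite (ord1 i) -real_normK ?num_real // expr_le1 // => /le_trans -> //.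
  exact: ltW.
have S0 : S !=set0.
  exists (delta_mx ord0 (Ordinal m0)); rewrite /S /= (bigD1 (Ordinal m0)) //=.
  rewrite /ev big1 ?mxE ?eqxx ?expr1n ?addr0 // => i ni.
  by rewrite mxE (negPf ni) andbF expr0n.
have [|c cin cmax] := EVT_max_rV S0 cS (f := fun v => qform a (ev v)).
  exact/continuous_subspaceT.
exists (ev c); split; first by move: cin; rewrite inE.
move=> y; set s := \sum_i y i ^+ 2.
have s0 : 0 <= s by apply: sumr_ge0 => i _; exact: sqr_ge0.
have [s_eq0|sn0] := eqVneq s 0.
  have y0 i : y i = 0.
    apply/eqP; rewrite -sqrf_eq0 eq_le sqr_ge0 andbT -s_eq0 /s (bigD1 i) //= lerDl.
    by apply: sumr_ge0 => j _; exact: sqr_ge0.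
  rewrite s_eq0 mulr0 /qform big1 // => i _; rewrite big1 // => j _.
  by rewrite y0 mulr0 mul0r.
have sp : 0 < s by rewrite lt_def sn0.
pose r := Num.sqrt s.
have rp : 0 < r by rewrite sqrtr_gt0.
have rs : r ^+ 2 = s by rewrite sqr_sqrtr.
pose w : 'rV[R]_m := \row_i (r^-1 * y i).
have wE : ev w = (fun i => r^-1 * y i) by apply/funext => i; rewrite /ev mxE.
have : qform a (ev w) <= qform a (ev c).
  apply: cmax; rewrite inE /S /= wE.
  have -> : \sum_i (r^-1 * y i) ^+ 2 = r^-1 ^+ 2 * s.
    by rewrite big_distrr; apply: eq_bigr => i _; rewrite exprMn.
  by rewrite -rs exprVn mulVf // expf_neq0 // gt_eqF.
by rewrite wE qformZ exprVn rs mulrC ler_pdivrMr.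
Qed.

End MaxRayleigh.

Section Mu.
Local Open Scope ring_scope.

(** As the entries are nonnegative, the absolute values of a maximizer again form a maximizer, hence
    a nonnegative eigenvector. Every eigenvalue is a Rayleigh quotient, so the maximum is the
    supremum [mu]. *)
Lemma mu_perron (R : realType) (G : sgraph) : (0 < #|G|)%N ->
  exists x : G -> R,
    [/\ forall u, 0 <= x u, exists u, 0 < x u,
        forall u, \sum_v (adj u v)%:R * x v = mu R G * x u
      & forall y : G -> R, qform (fun u v => (adj u v)%:R) y <= mu R G * \sum_u y u ^+ 2].
Proof.
move=> G0.
pose a (i j : 'I_#|G|) : R := (adj (enum_val i) (enum_val j))%:R.
have aC i j : a i j = a j i by rewrite /a adj_sym.
have a0 i j : 0 <= a i j by exact: ler0n.
have [x [x1 xmax]] := rayleigh_max a G0.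
pose l := qform a x.
pose z i := `|x i|.
have z1 : \sum_i z i ^+ 2 = 1.
  by rewrite -x1; apply: eq_bigr => i _; rewrite real_normK ?num_real.
have zE i : \sum_j a i j * z j = l * z i.
  apply: qform_eigen => //.
  apply/eqP; rewrite eq_le xmax /= z1 mulr1; exact: qform_normr.
have eigl : eigenvalue (adj_mx R G) l.
  apply/eigenvalueP; exists (\row_i z i).
    apply/rowP => j; rewrite !mxE -zE; apply: eq_bigr => i _.
    by rewrite !mxE mulrC -/(a i j) aC.
  apply/eqP => /rowP z0; move: z1; rewrite big1 => [/eqP|i _].
    by rewrite eq_sym oner_eq0.
  by have := z0 i; rewrite !mxE => ->; rewrite expr0n.
have ubl b : eigenvalue (adj_mx R G) b -> b <= l.
  move=> /eigenvalueP[v vE v0]; pose y i := v ord0 i.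
  have := xmax y.
  have -> : qform a y = b * \sum_i y i ^+ 2.
    rewrite big_distrr /qform exchange_big; apply: eq_bigr => j _ /=.
    have /rowP/(_ j) := vE; rewrite !mxE => vj.
    rewrite -big_distrl /= expr2 mulrA; congr (_ * _); rewrite -vj.
    by apply: eq_bigr => i _; rewrite !mxE mulrC.
  rewrite ler_pM2r // lt_def sumr_ge0 ?andbT => [|i _]; last exact: sqr_ge0.
  apply: contra v0; rewrite psumr_eq0 => [/allP h|i _]; last exact: sqr_ge0.
  apply/eqP/rowP => i; rewrite !mxE.
  by have := h i; rewrite mem_index_enum sqrf_eq0 => /(_ isT)/eqP.
have muE : mu R G = l.
  apply/eqP; rewrite eq_le; apply/andP; split.
    by apply: ge_sup => [|b]; [exists l | exact: ubl].
  by apply: ub_le_sup => //; exists l => b; exact: ubl.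
have sumE (F : G -> R) : \sum_u F u = \sum_(i < #|G|) F (enum_val i).
  by rewrite (reindex (@enum_val G predT)) //=; apply: onW_bij; exact: enum_val_bij.
exists (fun u => z (enum_rank u)); rewrite muE; split=> [u||u|y].
- exact: normr_ge0.
- have /existsP[i zi] : [exists i, z i != 0].
    apply: contra_eqT z1 => /existsPn h; rewrite big1 1?eq_sym ?oner_neq0 // => i _.
    by have := h i; rewrite negbK => /eqP->; rewrite expr0n.
  by exists (enum_val i); rewrite enum_valK lt_def zi normr_ge0.
- rewrite sumE -zE; apply: eq_bigr => i _.
  by rewrite enum_valK /a enum_rankK.
rewrite sumE; have := xmax (fun i => y (enum_val i)); congr (_ <= _).
rewrite /qform sumE; apply: eq_bigr => i _.
by rewrite sumE.
Qed.

End Mu.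

(** * Upper and lower estimates of the spectral radius *)

Section MuBounds.
Local Open Scope ring_scope.
Variable R : realType.

Definition adjR (G : sgraph) (u v : G) : R := (adj u v)%:R.

Lemma adjRC (G : sgraph) (u v : G) : adjR u v = adjR v u.
Proof. by rewrite /adjR adj_sym. Qed.

Lemma adjR_ge0 (G : sgraph) (u v : G) : 0 <= adjR u v.
Proof. exact: ler0n. Qed.

Lemma mu_rayleigh (G : sgraph) (y : G -> R) : (0 < #|G|)%N ->
  qform (@adjR G) y <= mu R G * \sum_u y u ^+ 2.
Proof. by move=> /(mu_perron R)[x [_ _ _]]; exact. Qed.

Lemma mu_ge0 (G : sgraph) : (0 < #|G|)%N -> 0 <= mu R G.
Proof.
move=> G0; have := @mu_rayleigh G (fun=> 1) G0.
rewrite expr1n sumr_const; set q := qform _ _ => qle.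
have q0 : 0 <= q.
  by apply: sumr_ge0 => i _; apply: sumr_ge0 => j _; rewrite !mulr1 adjR_ge0.
by have := le_trans q0 qle; rewrite pmulr_lge0 // ltr0n.
Qed.

(** The degree vector [d] is the image of the all-one vector under the adjacency matrix, whose norm
    is [m]. Polarization replaces diagonalization: the forms at [m * 1 + d] and [m * 1 - d] differ
    by four times [m * s], while each is at most [m] times the squared length in absolute value. *)
Lemma sum_degree_sq (G : sgraph) : (0 < #|G|)%N ->
  \sum_(u : G) (\sum_v adjR u v) ^+ 2 <= #|G|%:R * mu R G ^+ 2.
Proof.
move=> G0; set m := mu R G; pose d u := \sum_v @adjR G u v.
have m0 : 0 <= m by exact: mu_ge0.
have abs y : `|qform (@adjR G) y| <= m * \sum_u y u ^+ 2.
  rewrite ler_norml; apply/andP; split; last exact: mu_rayleigh.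
  rewrite lerNl; apply: le_trans (_ : qform (@adjR G) (fun u => `|y u|) <= _).
    rewrite -sumrN; apply: ler_sum => i _; rewrite -sumrN; apply: ler_sum => j _.
    rewrite -!mulrA -mulrN; apply: ler_wpM2l; first exact: adjR_ge0.
    by rewrite -normrM -normrN ler_norm.
  apply: le_trans (mu_rayleigh _ G0) _.
  by under eq_bigr do rewrite real_normK ?num_real //.
have [m_eq0|mn0] := eqVneq m 0.
  have d0 : \sum_u d u = 0.
    have := abs (fun=> 1); rewrite m_eq0 mul0r normr_le0 => /eqP q0.
    by rewrite -[RHS]q0; apply: eq_bigr => u _; apply: eq_bigr => v _; rewrite !mulr1.
  have du u : d u = 0.
    have dge0 v : 0 <= d v by apply: sumr_ge0 => w _; exact: adjR_ge0.
    apply/eqP; rewrite eq_le dge0 andbT -d0 (bigD1 u) //= lerDl.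
    by apply: sumr_ge0 => v _.
  by rewrite big1 => [|u _]; [rewrite m_eq0 expr0n mulr0 | rewrite -/(d u) du expr0n].
have mp : 0 < m by rewrite lt_def mn0.
set s := \sum_u _.
have h1 := abs (fun u => m * 1 + d u).
have h2 := abs (fun u => m * 1 + - 1 * d u).
move: h1 h2; rewrite !(qformD (@adjRC G)) !qformZ.
have -> : \sum_i d i * (\sum_j adjR i j * (m * 1)) = m * s.
  rewrite big_distrr; apply: eq_bigr => i _ /=.
  by rewrite -big_distrl /= -/(d i); ring.
have -> : \sum_i (-1 * d i) * (\sum_j adjR i j * (m * 1)) = - (m * s).
  rewrite big_distrr -sumrN; apply: eq_bigr => i _ /=.
  by rewrite -big_distrl /= -/(d i); ring.
have sq c : \sum_i (m * 1 + c * d i) ^+ 2 = #|G|%:R * m ^+ 2 + c * (2 * m * \sum_i d i) + c ^+ 2 * s.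
  rewrite -sum1_card natr_sum /s !(big_distrr, big_distrl) /= -!big_split /=.
  by apply: eq_bigr => i _; rewrite -/(d i); ring.
have := sq 1; under eq_bigr do rewrite mul1r; move=> ->.
rewrite sq !ler_norml => /andP[_ h1] /andP[h2 _].
have : 4 * (m * s) <= m * (2 * (#|G|%:R * m ^+ 2) + 2 * s) by move: h1 h2; lra.
by rewrite mulrCA ler_pM2l //; lra.
Qed.

(** The Collatz-Wielandt bound: the scalar product of [p] with a Perron vector is positive, and by
    symmetry the matrix may act on either factor. *)
Lemma mu_le_test (G : sgraph) (p : G -> R) t : (0 < #|G|)%N ->
  (forall u, 0 < p u) -> (forall u, \sum_v adjR u v * p v <= t * p u) ->
  mu R G <= t.
Proof.
move=> G0 p0 pt; have [x [x0 [w xw] xE _]] := mu_perron R G0.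
have sp : 0 < \sum_u x u * p u.
  rewrite (bigD1 w) //= ltr_wpDr ?mulr_gt0 //.
  by apply: sumr_ge0 => u _; rewrite mulr_ge0 // ltW.
rewrite -(ler_pM2r sp) !big_distrr /=.
under eq_bigr do rewrite mulrA -xE big_distrl /=.
rewrite exchange_big /=; apply: ler_sum => v _.
have -> : \sum_u (adj u v)%:R * x v * p u = x v * \sum_u adjR v u * p u.
  rewrite big_distrr; apply: eq_bigr => u _ /=; rewrite /adjR (adj_sym v u); ring.
by rewrite mulrCA; apply: ler_wpM2l.
Qed.

Lemma qform_morph (H1 H2 : sgraph) (f : H2 -> H1) (x : H1 -> R) :
  bijective f ->
  qform (@adjR H1) x =
    \sum_u \sum_v (adj (f u) (f v))%:R * x (f u) * x (f v).
Proof.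
move=> bf; rewrite /qform (reindex f) /=; last exact: onW_bij.
by apply: eq_bigr => u _; rewrite (reindex f) //=; exact: onW_bij.
Qed.

Lemma perron_rayleigh (G : sgraph) (x : G -> R) (l : R) :
  (forall u, \sum_v (adj u v)%:R * x v = l * x u) ->
  qform (@adjR G) x = l * \sum_u x u ^+ 2.
Proof.
move=> xE; rewrite big_distrr; apply: eq_bigr => u _ /=.
rewrite expr2 mulrA -xE big_distrl /=; apply: eq_bigr => v _; rewrite /adjR; ring.
Qed.

Lemma mu_le_morph (H1 H2 : sgraph) (f : H2 -> H1) : (0 < #|H1|)%N ->
  bijective f -> (forall u v, adj (f u) (f v) -> adj u v) ->
  mu R H1 <= mu R H2.
Proof.
move=> G0 bf sub; have [x [x0 [w xw] xE _]] := mu_perron R G0.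
have G0' : (0 < #|H2|)%N by rewrite (bij_eq_card bf).
have sp : 0 < \sum_u x u ^+ 2.
  rewrite (bigD1 w) //= ltr_wpDr ?exprn_gt0 //.
  by apply: sumr_ge0 => u _; exact: sqr_ge0.
rewrite -(ler_pM2r sp) -(perron_rayleigh xE) [X in _ <= _ * X](reindex f) /=; last exact: onW_bij.
apply: le_trans (mu_rayleigh (fun u => x (f u)) G0').
rewrite (qform_morph x bf); apply: ler_sum => u _; apply: ler_sum => v _.
rewrite -!mulrA; apply: ler_wpM2r; first by rewrite mulr_ge0.
by rewrite ler_nat; case: (boolP (adj (f u) _)) => // /sub ->.
Qed.

(** In a connected graph a zero of the Perron vector would spread to every vertex. So the vector is
    positive, and the extra edge [a b] strictly raises its Rayleigh quotient. *)
Lemma mu_lt_morph (H1 H2 : sgraph) (f : H2 -> H1) (a b : H2) :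
  (forall u v : H1, connect adj u v) ->
  bijective f -> (forall u v, adj (f u) (f v) -> adj u v) ->
  adj a b -> ~~ adj (f a) (f b) ->
  mu R H1 < mu R H2.
Proof.
move=> conn bf sub ab nab.
have G0 : (0 < #|H1|)%N by apply/card_gt0P; exists (f a).
have [x [x0 [w xw] xE _]] := mu_perron R G0.
have xpos u : 0 < x u.
  rewrite lt_def x0 andbT; apply/negP => /eqP xu.
  have cl : closed adj [pred v | x v == 0].
    suff h v v' : adj v v' -> x v = 0 -> x v' = 0.
      move=> v v' vv'; apply/eqP/eqP => /h; apply => //.
      by rewrite adj_sym.
    move=> vv' xv; have := xE v; rewrite xv mulr0 => /eqP.
    rewrite psumr_eq0 => [/allP/(_ v')|v2 _]; last by rewrite mulr_ge0.
    by rewrite mem_index_enum vv' mul1r => /(_ isT)/eqP.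
  have := closed_connect cl (conn u w); rewrite !inE xu eqxx.
  by move/esym/eqP => xw0; rewrite xw0 ltxx in xw.
have G0' : (0 < #|H2|)%N by rewrite (bij_eq_card bf).
have sp : 0 < \sum_u x u ^+ 2.
  rewrite (bigD1 w) //= ltr_wpDr ?exprn_gt0 //.
  by apply: sumr_ge0 => u _; exact: sqr_ge0.
rewrite -(ltr_pM2r sp) -(perron_rayleigh xE) [X in _ < _ * X](reindex f) /=; last exact: onW_bij.
apply: lt_le_trans (mu_rayleigh (fun u => x (f u)) G0').
rewrite (qform_morph x bf) /qform.
have le1 u v : (adj (f u) (f v))%:R * x (f u) * x (f v) <= adjR u v * x (f u) * x (f v).
  rewrite -!mulrA; apply: ler_wpM2r; first by rewrite mulr_ge0.
  by rewrite ler_nat; case: (boolP (adj (f u) _)) => // /sub ->.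
rewrite (bigD1 a) //= [ltRHS](bigD1 a) //=; apply: ltr_leD; last first.
  by apply: ler_sum => u _; apply: ler_sum => v _.
rewrite (bigD1 b) //= [ltRHS](bigD1 b) //=; apply: ltr_leD; last first.
  by apply: ler_sum => v _.
by rewrite /adjR (negPf nab) ab !mul0r mul1r mulr_gt0.
Qed.

End MuBounds.

(** * The complement of EP' *)

Definition ep_rel n (x y : nat) : bool :=
  (x < n - 6) && (y < n - 6) || ((x, y) \in EP'_edges n).

Definition ep_cadj n (x y : nat) : bool :=
  (x != y) && ~~ (ep_rel n x y || ep_rel n y x).

Lemma compl_EPE n (u v : EP' n) : @adj (compl (EP' n)) u v = ep_cadj n u v.
Proof.
rewrite /= /compl_adj /= /closure_adj /ep_cadj -val_eqE /=.
by case: eqP => //=.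
Qed.

Lemma ep_relE n x y : ep_rel n x y =
  [|| (x < n - 6) && (y < n - 6),
    (x == 0) && (y == n - 6), (x == n - 6) && (y == n - 6 + 1), (x == 0) && (y == n - 6 + 1),
    (x == 1) && (y == n - 6 + 2), (x == n - 6 + 2) && (y == n - 6 + 3), (x == 1) && (y == n - 6 + 3),
    (x == n - 6) && (y == n - 6 + 2), (x == n - 6) && (y == n - 6 + 4), (x == n - 6 + 2) && (y == n - 6 + 4),
    (x == n - 6 + 1) && (y == n - 6 + 3), (x == n - 6 + 1) && (y == n - 6 + 5)
    | (x == n - 6 + 3) && (y == n - 6 + 5)].
Proof. by rewrite /ep_rel /EP'_edges !inE !xpair_eqE. Qed.

Section EPBound.
Local Open Scope ring_scope.
Variable R : realType.

Lemma sum_ep_split n (f : nat -> R) : (8 <= n)%N ->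
  \sum_(v < n) f v = f 0%N + f 1%N + \sum_(2 <= v < n - 6) f v
    + (f (n - 6)%N + f (n - 6 + 1)%N + f (n - 6 + 2)%N + f (n - 6 + 3)%N
       + f (n - 6 + 4)%N + f (n - 6 + 5)%N).
Proof.
move=> n8.
have e1 : \sum_(0 <= v < n - 6) f v = f 0%N + f 1%N + \sum_(2 <= v < n - 6) f v.
  by rewrite big_ltn ?(@big_ltn _ _ _ 1) ?addrA //; lia.
have e2 m : \sum_(m <= v < m + 6) f v = f m + f (m + 1)%N + f (m + 2)%N + f (m + 3)%N
    + f (m + 4)%N + f (m + 5)%N.
  do 6! (rewrite big_ltn; last lia); rewrite big_geq ?addr0; last lia.
  by rewrite !addrA ![(m + _)%N]addnC.
rewrite -(big_mkord xpredT) (@big_cat_nat _ _ _ (n - 6)) /= ?e1; try lia.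
by rewrite -e2; congr (_ + bigop _ _ _); congr index_iota; lia.
Qed.

Lemma mu_compl_EP_le n (t : R) : (219 <= n)%N -> 24 < t ->
  t ^+ 2 = 5 / 2 * t + 6 * n%:R - 44 -> mu R (compl (EP' n)) <= t.
Proof.
move=> n219 t24 tE.
(* [y] and [z] give equality in the rows of the clique vertices. In the complement, [c2] sees weight
   [1 + y] more than [a2] does, and [y <= 1/5] makes [t * d = 6/5] enough to pay for it. *)
pose d : R := 6 / (5 * t); pose y := (4 + 2 * d) / t; pose z := (6 + 2 * d) / t.
have td : t * d = 6 / 5 by rewrite /d; field; lra.
have ty : t * y = 4 + 2 * d by rewrite /y; field; lra.
have tz : t * z = 6 + 2 * d by rewrite /z; field; lra.
have d0 : 0 < d by rewrite divr_gt0; lra.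
have y0 : 0 < y by rewrite divr_gt0; lra.
have z0 : 0 < z by rewrite divr_gt0; lra.
have d1 : d < 1 by nra.
have y5 : y <= 1 / 5 by nra.
(* The row of [a2], and equally of [a3], [b2] and [b3]. *)
have main : (n%:R - 8) * z + y + 2 + d <= t.
  have : ((n%:R - 8) * z + y + 2 + d) * t <= t * t; last by rewrite ler_pM2r //; lra.
  have -> : ((n%:R - 8) * z + y + 2 + d) * t =
      (n%:R - 8) * (t * z) + t * y + 2 * t + t * d by ring.
  rewrite ty tz td.
  suff : (n%:R - 7) * (2 * d) <= t / 2 - 6 / 5.
    by rewrite -expr2 tE; lra.
  have : (n%:R - 7) * (2 * d) * t <= (t / 2 - 6 / 5) * t; last by rewrite ler_pM2r //; lra.
  have -> : (n%:R - 7) * (2 * d) * t = (n%:R - 7) * (2 * (t * d)) by ring.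
  rewrite td; nra.
(* The test vector is [y] on a1, b1, [z] on the rest of Q, 1 on a2, a3, b2, b3 and
   [1 + d] on c2, c3. *)
pose p (v : nat) : R := if (v < 2)%N then y else if (v < n - 6)%N then z
  else if (v < n - 6 + 4)%N then 1 else 1 + d.
have p0 v : 0 < p v.
  by rewrite /p; case: ifP => // _; case: ifP => // _; case: ifP => // _; lra.
have cn : (0 < #|compl (EP' n)|)%N by rewrite [#|_|](card_ord n); apply: leq_trans n219.
apply: (@mu_le_test R (compl (EP' n)) (fun u : 'I_n => p u) t cn) => [u|u]; first exact: p0.
pose f v := (ep_cadj n u v)%:R * p v.
have -> : \sum_v @adjR R (compl (EP' n)) u v * p v = \sum_(v < n) f v.
  by apply: eq_bigr => v _; rewrite /adjR compl_EPE.
rewrite sum_ep_split; last lia.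
have fle v : f v <= p v by rewrite /f; case: (ep_cadj _ _ _); rewrite ?mul1r // mul0r ltW.
have f0 v : ~~ ep_cadj n u v -> f v = 0 by rewrite /f => /negPf->; rewrite mul0r.
have mid_le : \sum_(2 <= v < n - 6) f v <= (n%:R - 8) * z.
  apply: le_trans (_ : \sum_(2 <= v < n - 6) z <= _).
    rewrite big_nat [leRHS]big_nat; apply: ler_sum => v /andP[v2 vq].
    by apply: le_trans (fle v) _; rewrite /p ltnNge v2 vq. 
  rewrite sumr_const_nat -[z *+ _]mulr_natl -subnDA natrB; last by apply: leq_trans n219.
  by rewrite lexx.
have mid0 : (u < n - 6)%N -> \sum_(2 <= v < n - 6) f v = 0.
  move=> uq; rewrite big_nat big1 // => v /andP[_ vq].
  by apply: f0; rewrite /ep_cadj /ep_rel uq vq andbF.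
have pqj j : p (n - 6 + j)%N = if (j < 4)%N then 1 else 1 + d.
  rewrite /p ltn_add2l ifF; last by clear -n219; lia.
  by rewrite ifF //; clear; lia.
have pq : p (n - 6)%N = 1 by rewrite -[(n - 6)%N]addn0 pqj.
have pq1 := pqj 1%N; have pq2 := pqj 2%N; have pq3 := pqj 3%N.
have pq4 := pqj 4%N; have pq5 := pqj 5%N; rewrite /= in pq1 pq2 pq3 pq4 pq5.
have := fle 0%N; have := fle 1%N; have := fle (n - 6)%N; have := fle (n - 6 + 1)%N.
have := fle (n - 6 + 2)%N; have := fle (n - 6 + 3)%N; have := fle (n - 6 + 4)%N.
have := fle (n - 6 + 5)%N; rewrite pq pq1 pq2 pq3 pq4 pq5 [p 0]/p [p 1]/p /=.
move=> l5 l4 l3 l2 l1 l0 lb la.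
have un := ltn_ord u.
have zero v : (ep_rel n u v || ep_rel n v u) || (nat_of_ord u == v) -> f v = 0.
  by move=> h; apply: f0; rewrite /ep_cadj; case: eqP h => //= _; rewrite orbF => ->.
have zself v : nat_of_ord u = v -> f v = 0 by move=> <-; apply: zero; rewrite eqxx orbT.
have q1 : (1 < n - 6)%N by clear -n219; lia.
have q0 : (0 < n - 6)%N by exact: ltnW.
have [uq|uq] := ltnP u (n - 6).
  rewrite (mid0 uq) (zero 0%N) ?(zero 1%N) /ep_rel ?uq ?q0 ?q1 //.
  have [u0|u0] := eqVneq (nat_of_ord u) 0%N.
    rewrite (zero (n - 6)%N) ?(zero (n - 6 + 1)%N); try by rewrite u0 !ep_relE !eqxx /= ?orbT.
    have -> : p u = y by rewrite /p u0.
    clear -l2 l3 l4 l5 ty; lra.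
  have [u1|u1] := eqVneq (nat_of_ord u) 1%N.
    rewrite (zero (n - 6 + 2)%N) ?(zero (n - 6 + 3)%N); try by rewrite u1 !ep_relE !eqxx /= ?orbT.
    have -> : p u = y by rewrite /p u1.
    clear -l0 l1 l4 l5 ty; lra.
  have -> : p u = z.
    by rewrite /p uq ifF //; move: u0 u1; case: (nat_of_ord u) => [|[|]].
  clear -l0 l1 l2 l3 l4 l5 tz; lra.
have [j ue j6] : exists2 j, nat_of_ord u = (n - 6 + j)%N & (j < 6)%N.
  by exists (u - (n - 6))%N; move: un uq; clear -n219; lia.
case: j ue j6 => [|[|[|[|[|[|]]]]]] // e _.
- rewrite addn0 in e.
  rewrite (zero 0%N) ?(zero (n - 6 + 1)%N) ?(zero (n - 6 + 2)%N) ?(zero (n - 6 + 4)%N) ?(zself _ e) ?e ?pq;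
    try by rewrite ?e !ep_relE !eqxx /= ?orbT.
  clear -lb mid_le l3 l5 main; lra.
- rewrite (zero 0%N) ?(zero (n - 6)%N) ?(zero (n - 6 + 3)%N) ?(zero (n - 6 + 5)%N) ?(zself _ e) ?e ?pq1;
    try by rewrite ?e !ep_relE !eqxx /= ?orbT.
  clear -lb mid_le l2 l4 main; lra.
- rewrite (zero 1%N) ?(zero (n - 6)%N) ?(zero (n - 6 + 3)%N) ?(zero (n - 6 + 4)%N) ?(zself _ e) ?e ?pq2;
    try by rewrite ?e !ep_relE !eqxx /= ?orbT.
  clear -la mid_le l1 l5 main; lra.
- rewrite (zero 1%N) ?(zero (n - 6 + 1)%N) ?(zero (n - 6 + 2)%N) ?(zero (n - 6 + 5)%N) ?(zself _ e) ?e ?pq3;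
    try by rewrite ?e !ep_relE !eqxx /= ?orbT.
  clear -la mid_le l0 l4 main; lra.
- rewrite (zero (n - 6)%N) ?(zero (n - 6 + 2)%N) ?(zself _ e) ?e ?pq4;
    try by rewrite ?e !ep_relE !eqxx /= ?orbT.
  clear -la lb mid_le l1 l3 l5 main td y5; lra.
rewrite (zero (n - 6 + 1)%N) ?(zero (n - 6 + 3)%N) ?(zself _ e) ?e ?pq5;
  try by rewrite ?e !ep_relE !eqxx /= ?orbT.
clear -la lb mid_le l0 l2 l4 main td y5; lra.
Qed.

End EPBound.

(** * The extremal case *)

Lemma claw_free_clawless (G : sgraph) : claw_free G -> clawless (@adj G).
Proof.
move=> cf x a b c xa xb xc ab ac bc; apply/negPn/negP => /norP[nab /norP[nac nbc]]; apply: cf.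
pose l (j : 'I_3) := nth x [:: a; b; c] j.
exists (fun s : 'I_1 + 'I_3 => if s is inr j then l j else x).
have xl j : adj x (l j) by case: j => [[|[|[|]]]].
have u3 : uniq [:: a; b; c] by rewrite /= !inE negb_or ab ac bc.
have linj i j : l i = l j -> i = j.
  by move=> /eqP; rewrite nth_uniq // => /eqP/val_inj.
have nl i j : adj (l i) (l j) = false.
  apply/negbTE; case: i j => [[|[|[|]]] // i3] [[|[|[|]]] // j3] /=;
    by rewrite ?adj_irrefl // adj_sym.
have bip (u v : complete_bipartite 1 3) : adj u v = (u != v) &&
    ((is_inl u && ~~ is_inl v) || (is_inl v && ~~ is_inl u)) by [].
split=> [[i|i] [j|j] //= e|[i|i] [j|j]].
- by rewrite (ord1 i) (ord1 j).
- by have := xl j; rewrite -e adj_irrefl.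
- by have := xl i; rewrite e adj_irrefl.
- by rewrite (linj _ _ e).
- by rewrite adj_irrefl bip /= andbF.
- by rewrite xl bip.
- by rewrite adj_sym xl bip.
by rewrite nl bip /= andbF.
Qed.

Lemma k_connected_two (G : sgraph) (F : rel G) : subrel adj F ->
  k_connected 2 G -> two_connected F.
Proof.
move=> GF [_ c2] X X2 x y xX yX; apply: connect_sub (c2 X X2 x y xX yX) => a b.
by case/and3P=> aX bX /GF ab; apply: connect1; rewrite aX bX.
Qed.

Lemma ep_rel_out n i j : 8 <= n ->
  ep_rel n (n - 6 + i) (n - 6 + j) = ((i, j) \in ep_edges).
Proof.
move=> n8; rewrite ep_relE /ep_edges !inE !xpair_eqE.
have [q qE q2] : exists2 q, n - 6 = q & 1 < q by exists (n - 6) => //; lia.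
have e0 k : (q + k == q) = (k == 0) by rewrite -{2}[q]addn0 eqn_add2l.
have e1 k : (q + k == 0) = false by lia.
have e2 k : (q + k == 1) = false by lia.
have e3 k : (q + k < q) = false by lia.
by rewrite qE !e0 !e1 !e2 !e3 !eqn_add2l /= ?orbF.
Qed.

Lemma ep_rel_in n i j : 8 <= n -> i < n - 6 -> j < 6 ->
  ep_rel n i (n - 6 + j) || ep_rel n (n - 6 + j) i =
    (j < 2) && (i == 0) || (1 < j < 4) && (i == 1).
Proof.
move=> n8; rewrite !ep_relE.
have [q qE q2] : exists2 q, n - 6 = q & 1 < q by exists (n - 6) => //; lia.
rewrite qE => iq j6.
have e0 k : (q + k == q) = (k == 0) by rewrite -{2}[q]addn0 eqn_add2l.
have e1 k : (q + k == 0) = false by lia.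
have e2 k : (q + k == 1) = false by lia.
have e3 k : (q + k < q) = false by lia.
have e4 : (i == q) = false by lia.
have e5 k : (i == q + k) = false by lia.
rewrite !e0 !e1 !e2 !e3 !e4 !e5 !eqn_add2l /= ?andbF ?orbF /=.
by case: j j6 => [|[|[|[|[|[|]]]]]] //= _; case: (i == 0); case: (i == 1).
Qed.

Lemma EP_adjE n (u v : EP' n) : @adj (EP' n) u v =
  (u != v :> nat) && (ep_rel n u v || ep_rel n v u).
Proof. by []. Qed.

(** Two hubs: the clique vertex 2, here called [c2], sees all six outside vertices in the
    complement, and the outside vertex [n - 6 + 4], called [o4], sees the whole clique. *)
Lemma compl_EP_connected n (u v : compl (EP' n)) : 219 <= n -> connect adj u v.
Proof.
move=> n219; have n8 : 8 <= n by exact: leq_trans n219.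
have l2 : 2 < n by exact: leq_trans n219.
have l4 : n - 6 + 4 < n by lia.
pose c2 : compl (EP' n) := Ordinal l2; pose o4 : compl (EP' n) := Ordinal l4.
have adjE (a b : compl (EP' n)) : adj a b = ep_cadj n a b by exact: compl_EPE.
have in_out (a b : compl (EP' n)) j : 2 <= a < n - 6 \/ a < n - 6 /\ j = 4 ->
    nat_of_ord b = n - 6 + j -> j < 6 -> adj a b.
  move=> h bE j6; have aq : a < n - 6 by case: h => [/andP[]|[]].
  rewrite adjE /ep_cadj bE ep_rel_in //; apply/andP; split; first by move: aq; lia.
  by case: h => [/andP[a2 _]|[_ ->]] //; move: a2; case: (nat_of_ord a) => [|[|]] // k _; rewrite !andbF.
have to4 (a : compl (EP' n)) : a < n - 6 -> connect adj a o4.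
  by move=> aq; apply: connect1; apply: (in_out a o4 4) => //; right.
have q2 : 2 < n - 6 by lia.
have toc (a : compl (EP' n)) : connect adj a c2.
  have [aq|qa] := ltnP a (n - 6).
    apply: connect_trans (to4 a aq) _; apply: connect1; rewrite adj_sym.
    by apply: (in_out c2 o4 4) => //; left.
  apply: connect1; rewrite adj_sym; apply: (in_out c2 a (a - (n - 6))).
  - by left.
  - by rewrite subnKC.
  by have := ltn_ord a; lia.
have sym : connect_sym (@adj (compl (EP' n))) by apply: sym_connect_sym => a b; exact: adj_sym.
by apply: connect_trans (toc u) _; rewrite sym.
Qed.

Lemma ep_structure_iso (T : finType) (F : rel T) (K : {set T}) (g : T) n :
  symmetric F -> irreflexive F -> 219 <= n -> #|T| = n ->
  {in K &, forall x y, x != y -> F x y} -> ep_structure F K g ->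
  exists f : T -> EP' n, bijective f /\ forall x y, @adj (EP' n) (f x) (f y) = F x y.
Proof.
move=> FC FI n219 cT Kcl [k1 [k2 [s [[k1K k2K k12] us ss sK [Fss FsK]]]]].
have n8 : 8 <= n by exact: leq_trans n219.
pose rest := [seq k <- enum K | (k != k1) && (k != k2)].
(* The numbering of EP': the special clique vertices are 0 and 1, the clique ends at [n - 7], and
   [s] fills the last six places. *)
pose o := k1 :: k2 :: rest ++ s.
have uo : uniq o.
  rewrite /o /= !inE !mem_cat !mem_filter !sK k1K k2K !eqxx /= !andbF !orbF k12 /=.
  rewrite cat_uniq filter_uniq ?enum_uniq // us andbT; apply/hasPn => x.
  by rewrite sK mem_filter mem_enum /=; case: (x \in K); rewrite ?andbF.
have mo x : x \in o.
  rewrite !inE mem_cat mem_filter mem_enum sK.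
  by case: eqP => //= _; case: eqP => //= _; case: (x \in K).
have so : size o = n.
  by rewrite -cT -(card_uniqP uo); apply: eq_card => x; rewrite mo.
have sr : (size rest).+2 = n - 6 by move: so; rewrite /= size_cat ss; lia.
have lt x : index x o < n by rewrite -so index_mem.
pose f x : EP' n := Ordinal (lt x).
have finj : injective f.
  move=> x y [e]; have := nth_index x (mo x).
  by rewrite [index x o]e nth_index.
exists f; split; first by apply: inj_card_bij => //; rewrite card_ord cT.
have idxK x : x \in K -> index x o < n - 6.
  move=> xK; rewrite -sr (_ : o = (k1 :: k2 :: rest) ++ s) // index_cat.
  have -> : x \in k1 :: k2 :: rest.
    rewrite !inE mem_filter mem_enum xK andbT.
    by case: eqP => //= _; case: eqP.
  by rewrite -[X in _ < X]/(size (k1 :: k2 :: rest)) index_mem; rewrite !inE mem_filter mem_enum xK andbT; case: eqP => //= _; case: eqP.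
have idxs x : x \notin K -> exists j, [/\ j < 6, x = nth g s j & index x o = n - 6 + j].
  move=> xK; have xs : x \in s by rewrite sK.
  exists (index x s); rewrite nth_index //; split=> //; first by rewrite -ss index_mem.
  rewrite -sr (_ : o = (k1 :: k2 :: rest) ++ s) // index_cat.
  rewrite ifF //; apply/negbTE; rewrite !inE mem_filter mem_enum (negPf xK) andbF orbF.
  by apply/norP; split; apply: contraNneq xK => ->.
have fE x y : (f x != f y :> nat) = (x != y).
  by rewrite (inj_eq (@ord_inj n)) (inj_eq finj).
have i0 x : (index x o == 0) = (x == k1).
  by rewrite /= [k1 == x]eq_sym; case: (eqVneq x k1).
have i1 x : (index x o == 1) = (x == k2).
  rewrite /= [k1 == x]eq_sym [k2 == x]eq_sym; case: (eqVneq x k1) => [->|_] /=.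
    by rewrite (negPf k12).
  by case: (eqVneq x k2).
have mixed x y : x \in K -> y \notin K ->
    ep_rel n (f x) (f y) || ep_rel n (f y) (f x) = F x y.
  move=> xK yK; have [j [j6 yE jE]] := idxs y yK.
  rewrite -[nat_of_ord (f y)]/(index y o) jE ep_rel_in //; last exact: idxK.
  by rewrite -[nat_of_ord (f x)]/(index x o) i0 i1 FC yE FsK.
have neqK x y : x \in K -> y \notin K -> x != y.
  by move=> xK yK; apply: contraTneq xK => ->.
move=> x y; rewrite EP_adjE fE.
have [xK|xK] := boolP (x \in K); have [yK|yK] := boolP (y \in K).
- have -> : ep_rel n (f x) (f y) by rewrite /ep_rel !idxK.
  by have [->|xy] := eqVneq x y; [rewrite FI | rewrite Kcl].
- by rewrite mixed // neqK.
- by rewrite orbC mixed // FC eq_sym neqK.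
have [i [i6 xE iE]] := idxs x xK; have [j [j6 yE jE]] := idxs y yK.
rewrite -[nat_of_ord (f y)]/(index y o) -[nat_of_ord (f x)]/(index x o) iE jE !ep_rel_out //.
rewrite -Fss // -xE -yE.
by case: (eqVneq x y) => [->|//]; rewrite FI.
Qed.

(** * The threshold and the sparse case *)

Section Threshold.
Local Open Scope ring_scope.
Variable R : realType.

(* Up to constants, [t ^+ 2] has to exceed [12 / 5 * t + 6 * n] for [mu_compl_EP_le]
   and to stay below [8 / 3 * t + 6 * n] for [six_outside_sparse]. *)
Lemma threshold n : (219 <= n)%N -> exists t : R,
  [/\ 24 < t, t ^+ 2 = 5 / 2 * t + 6 * n%:R - 44 & t ^+ 2 <= 25 / 4 * n%:R].
Proof.
move=> n219; have nR : 219 <= n%:R :> R by rewrite ler_nat.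
pose w : R := Num.sqrt (25 / 16 + 6 * n%:R - 44).
have w2 : w ^+ 2 = 25 / 16 + 6 * n%:R - 44 by rewrite sqr_sqrtr //; lra.
have w0 : 0 <= w by exact: sqrtr_ge0.
have w30 : 30 < w.
  rewrite ltNge; apply/negP => h; have : w * w <= 30 * 30 by exact: ler_pM.
  rewrite -expr2 w2; lra.
exists (5 / 4 + w); split; first lra.
  by rewrite sqrrD w2; field.
(* This bounds [5/2 * w] by [w^2 / 24 + 75/2], and 25/24 of [6 * n] is [25/4 * n]. *)
have : (w - 30) ^+ 2 >= 0 by exact: sqr_ge0.
rewrite sqrrB sqrrD w2 => h; lra.
Qed.

Lemma sum_conbrs_sq_le (T : finType) (F : rel T) (FC : symmetric F) (FI : irreflexive F) (b : R) :
  (0 < #|T|)%N -> mu R (compl (SGraph FC FI)) <= b ->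
  (\sum_u #|conbrs F u| ^ 2)%N%:R <= #|T|%:R * b ^+ 2.
Proof.
move=> T0 mb; have := @sum_degree_sq R (compl (SGraph FC FI)) T0.
have := @mu_ge0 R (compl (SGraph FC FI)) T0 => m0.
have -> : \sum_(u : compl (SGraph FC FI)) (\sum_v @adjR R (compl (SGraph FC FI)) u v) ^+ 2 =
    (\sum_u #|conbrs F u| ^ 2)%N%:R.
  rewrite natr_sum; apply: eq_bigr => u _; rewrite natrX -sum1_card; congr (_ ^+ 2).
  rewrite natr_sum [RHS]big_mkcond /=; apply: eq_bigr => v _.
  by rewrite /adjR inE /= /nonadj /compl_adj /=; case: ifP.
move=> /le_trans; apply; apply: ler_wpM2l => //.
by rewrite ler_sqr ?nnegrE // (le_trans m0).
Qed.

Lemma six_outside_sparse (T : finType) (F : rel T) (FC : symmetric F) (FI : irreflexive F)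
    (K : {set T}) n (t : R) : (219 <= n)%N -> #|T| = n -> 24 < t ->
  t ^+ 2 = 5 / 2 * t + 6 * n%:R - 44 ->
  (forall u, u \notin K -> {in K &, forall k k', F u k -> F u k' -> k = k'}) ->
  #|~: K| = 6%N -> (\sum_(u | u \notin K) #|[pred v | (v \notin K) && F u v]| <= 14)%N ->
  t < mu R (compl (SGraph FC FI)).
Proof.
move=> n219 cT t24 tE K1 c6 e14; set H := compl _.
have nR : 219 <= n%:R :> R by rewrite ler_nat.
have H0 : (0 < #|H|)%N by rewrite [#|_|]cT; apply: leq_trans n219.
have HE u v : @adjR R H u v = (nonadj F u v)%:R by [].
(* In the complement most clique vertices see just the six outside vertices, so an eigenvector for a
   value near [t] has weights in ratio about 6 to [t]. *)
pose y (u : H) : R := if u \in K then 6 else t.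
have cK : #|K|%:R = n%:R - 6 :> R.
  by rewrite -cT -(cardsC K) c6 natrD; ring.
have ysq : \sum_u y u ^+ 2 = 36 * (n%:R - 6) + 6 * t ^+ 2.
  have -> : \sum_u y u ^+ 2 = \sum_(u in K) (36 : R) + \sum_(u in ~: K) t ^+ 2.
    rewrite (bigID (mem K)) /=; congr (_ + _).
      by apply: eq_bigr => u uK; rewrite /y uK expr2; ring.
    by apply: eq_big => u; rewrite ?inE // => /negPf uK; rewrite /y uK.
  rewrite !sumr_const c6 -[36 *+ _]mulr_natr cK -[t ^+ 2 *+ 6]mulr_natl. reflexivity.
have cK' : (#|K| = n - 6)%N by rewrite -cT -(cardsC K) c6 addnK.
have sumE (P Q : pred T) (u : T) : \sum_(v | P v) (Q v)%:R = #|[pred v | P v & Q v]|%:R :> R.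
  rewrite -sum1_card natr_sum big_mkcond [RHS]big_mkcond; apply: eq_bigr => v _ /=.
  by rewrite !inE; case: (P v); case: (Q v).
have inout : \sum_(u | u \notin K) \sum_(k in K) (nonadj F u k)%:R >= 6 * (n%:R - 7) :> R.
  have -> : 6 * (n%:R - 7) = \sum_(u in ~: K) (n%:R - 7) :> R.
    by rewrite sumr_const c6 -[RHS]mulr_natl.
  rewrite [leRHS](eq_bigl (mem (~: K))) => [|u]; last by rewrite !inE.
  apply: ler_sum => u; rewrite inE => uK; rewrite sumE //.
  have := card_nonadj_clique uK (K1 u uK); rewrite cK' -subnDA -(ler_nat R) natrB; last first.
    by apply: leq_trans n219.
  move=> /le_trans; apply; rewrite ler_nat; apply: eq_leq; apply: eq_card => k.
  by rewrite !inE.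
(* Of the 30 ordered pairs of outside vertices at most 14 are adjacent. *)
have outout : \sum_(u | u \notin K) \sum_(v | v \notin K) (nonadj F u v)%:R >= 16 :> R.
  under eq_bigr do rewrite sumE //.
  rewrite -natr_sum ler_nat.
  have row u : u \notin K ->
      (#|[pred v | (v \notin K) && F u v]| + #|[pred v | v \notin K & nonadj F u v]| = 5)%N.
    move=> uK; have := cardsD1 u (~: K); rewrite inE uK c6 add1n => -[e5]; rewrite [RHS]e5.
    rewrite -(cardID (F u) (mem (~: K :\ u))); congr addn; apply: eq_card => v; rewrite !inE.
      case: (eqVneq v u) => [->|_]; first by rewrite FI /= !andbF.
      by rewrite /= andbC.
    have -> : (v \in F u) = F u v by [].
    by rewrite /nonadj (eq_sym u); case: (v == u); case: (v \in K); case: (F u v).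
  have : (\sum_(u | u \notin K) (#|[pred v | (v \notin K) && F u v]| +
      #|[pred v | v \notin K & nonadj F u v]|) = 30)%N.
    rewrite (eq_bigr (fun=> 5%N)) // (eq_bigl (mem (~: K))) => [|u]; last by rewrite !inE.
    by rewrite sum_nat_const c6.
  rewrite big_split /=; move: e14; clear; lia.
have := @mu_rayleigh R H y H0; rewrite ysq ltNge => q; apply/negP => le.
have : qform (@adjR R H) y >= 16 * t ^+ 2 + 72 * (n%:R - 7) * t.
  have yK u : u \in K -> y u = 6 by rewrite /y => ->.
  have yO u : u \notin K -> y u = t by rewrite /y => /negPf->.
  have y0 u : 0 <= y u by rewrite /y; case: ifP => // _; lra.
  have a0 u v : 0 <= adjR R u v * y u * y v :> R by rewrite !mulr_ge0 ?adjR_ge0.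
  rewrite /qform (bigID (mem K)) /=.
  have -> : \sum_(u | u \notin K) \sum_v @adjR R H u v * y u * y v =
      6 * t * (\sum_(u | u \notin K) \sum_(k in K) (nonadj F u k)%:R) +
      t ^+ 2 * (\sum_(u | u \notin K) \sum_(v | v \notin K) (nonadj F u v)%:R).
    rewrite !big_distrr -big_split /=; apply: eq_bigr => u uK.
    rewrite (bigID (mem K)) !big_distrr /=; congr (_ + _); apply: eq_bigr => v vK.
      by rewrite HE (yO u uK) (yK v vK); ring.
    by rewrite HE (yO u uK) (yO v vK); ring.
  have : 6 * t * (\sum_(u | u \notin K) \sum_(k in K) (nonadj F u k)%:R) <=
      \sum_(k in K) \sum_v @adjR R H k v * y k * y v.
    rewrite exchange_big big_distrr /=; apply: ler_sum => k kK.
    rewrite [leRHS](bigID (mem K)) /= big_distrr /=.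
    apply: ler_wpDl; first by apply: sumr_ge0 => v _.
    apply: ler_sum => v vK; rewrite HE (yK k kK) (yO v vK) (nonadjC FC k).
    by rewrite le_eqVlt; apply/orP; left; apply/eqP; ring.
  set s1 := \sum_(k in K) _; set s2 := \sum_(u | _) _; set s3 := \sum_(u | _) _ => h.
  have : 6 * t * s2 >= 6 * t * (6 * (n%:R - 7)) by rewrite ler_pM2l //; lra.
  have : t ^+ 2 * s3 >= t ^+ 2 * 16 by rewrite ler_pM2l // exprn_gt0 //; lra.
  lra.
have : mu R H * (36 * (n%:R - 6) + 6 * t ^+ 2) <= t * (36 * (n%:R - 6) + 6 * t ^+ 2).
  by apply: ler_wpM2r => //; nra.
move=> h1 h2; have t0 : 0 < t by lra.
(* Inserting [tE] cancels all terms in [n] and leaves exactly [t <= 24]: the constant 44 and the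
   bound 24 belong together. *)
have h3 : 16 * t + 72 * (n%:R - 7) <= 36 * (n%:R - 6) + 6 * t ^+ 2.
  rewrite -(ler_pM2l t0); lra.
have tle : t <= 24 by lra.
by rewrite leNgt t24 in tle.
Qed.
End Threshold.

Theorem theorem10 (R : realType) (n : nat) (G : sgraph) :
  219 <= n ->
  #|G| = n ->
  k_connected 2 G ->
  claw_free G ->
  (mu R (compl G) <= mu R (compl (EP' n)))%R ->
  ~ isomorphic G (EP' n) -> hamiltonian G.
Proof.
move=> n219 cG G2 Gcf mule niso.
have T3 : 2 < #|G| by rewrite cG; apply: leq_trans n219.
have T0 : 0 < #|G| by exact: leq_trans T3.
have [F [FC FI GF Fcf [Fdf Fham]]] :=
  claw_free_closure T3 (@adj_sym G) (@adj_irrefl G) (claw_free_clawless Gcf).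
apply: Fham; have [t [t24 tE t2]] := threshold R n219.
have mu0t := mu_compl_EP_le n219 t24 tE.
have muF : (mu R (compl (SGraph FC FI)) <= mu R (compl G))%R.
  apply: (@mu_le_morph R (compl (SGraph FC FI)) (compl G) id) => //; first by exists id.
  by move=> u v /=; rewrite /compl_adj /= => /andP[-> /=]; apply: contra; exact: GF.
have muFt := le_trans muF (le_trans mule mu0t).
have sq := sum_conbrs_sq_le T0 muFt.
have [||K [Kcl K1 K6]] := large_clique FC FI Fcf Fdf; first by rewrite cG.
  rewrite -(ler_nat R) !natrM.
  have : ((#|G|%:R * t ^+ 2) <= #|G|%:R * (25 / 4 * #|G|%:R) :> R)%R.
    by rewrite ler_pM2l ?ltr0n // cG.
  rewrite expr2; lra.
have F2 : two_connected F by exact: k_connected_two GF G2.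
(* Each of the at most six outside vertices has at most one neighbour in [K], and [K] is larger than
   its complement. *)
have [g gK gfar] : exists2 g, g \in K & forall u, u \notin K -> ~~ F u g.
  pose foot u := odflt u [pick k in K | F u k].
  have KG : #|~: K| < #|K| by have := cardsC K; rewrite cG; lia.
  have /subsetPn[g gK gn] : ~~ (K \subset [set foot u | u in ~: K]).
    by apply/negP => /subset_leq_card; rewrite leqNgt (leq_ltn_trans (leq_imset_card _ _)).
  exists g => // u uK; apply: contra gn => ug; apply/imsetP; exists u; first by rewrite inE.
  rewrite /foot; case: pickP => [k /andP[kK uk]|/(_ g)]; last by rewrite gK ug.
  exact: (K1 u).
case: (small_remainder FC FI Fcf Fdf Kcl K1 gK gfar T3 F2 K6) => [//|[c6 e14]|ep].
  have := six_outside_sparse FC FI n219 cG t24 tE K1 c6 e14.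
  by rewrite ltNge muFt.
have [f [bf fE]] := ep_structure_iso FC FI n219 cG Kcl ep.
exfalso; have [/forallP all|/forallPn[[a b] /=]] :=
    boolP [forall e : G * G, F e.1 e.2 ==> adj e.1 e.2].
  apply: niso; exists f; split=> // x y; rewrite fE; apply/idP/idP => [h|]; last exact: GF.
  by have := all (x, y); rewrite /= h.
rewrite negb_imply => /andP[Fab nab].
suff : (mu R (compl (EP' n)) < mu R (compl G))%R by rewrite ltNge mule.
have ab : a != b by apply: contraTneq Fab => ->; rewrite FI.
apply: (@mu_lt_morph R (compl (EP' n)) (compl G) f a b) => //.
- by move=> u v; exact: compl_EP_connected.
- move=> u v /=; rewrite /compl_adj fE => /andP[fuv nF].
  apply/andP; split; first by apply: contraNneq fuv => ->.
  by apply: contra nF; exact: GF.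
- by rewrite /= /compl_adj ab.
by rewrite /= /compl_adj fE Fab andbF.
Qed.
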